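(* Let $k\ge 1$, $0<\gamma\le 1$, and let $P$ be a probability measure on $\mathbb{R}^k$ with $P(H)<\gamma$ for every (affine) hyperplane $H\subset\mathbb{R}^k$. Let $\phi\in K_P(\gamma)$ be such that $(T_P(\phi),C_P(\phi))$ is an MCD functional at $P$, i.e. $\phi$ minimizes $\det(C_P(\cdot))$ over $K_P(\gamma)$, and let $E_P(\phi)=E(T_P(\phi),C_P(\phi),r_P(\phi))$ be the corresponding minimizing ellipsoid, with interior $E_P(\phi)^\circ$ and boundary $\partial E_P(\phi)$. Then $$\int\phi\,dP=\gamma\qquad\text{and}\qquad \mathbf{1}_{E_P(\phi)^\circ}\le\phi\le\mathbf{1}_{E_P(\phi)}\quad P\text{-a.e.}$$ Furthermore, either $\phi=0$ $P$-a.e. on $\partial E_P(\phi)$, or $\phi=1$ $P$-a.e. on $\partial E_P(\phi)$, or there exists $x\in\partial E_P(\phi)$ such that $P(\partial E_P(\phi))=P(\{x\})$.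
   Context: For a probability measure $P$ on $\mathbb{R}^k$ let $K_P(\gamma)$ be the set of measurable functions $\phi:\mathbb{R}^k\to[0,1]$ with $\int\phi\,dP\ge\gamma$ and $\int\|x\|^2\phi(x)\,P(dx)<\infty$. For $\phi\in K_P(\gamma)$ define $$T_P(\phi)=\frac{1}{\int\phi\,dP}\int x\,\phi(x)\,P(dx),\qquad C_P(\phi)=\frac{1}{\int\phi\,dP}\int (x-T_P(\phi))(x-T_P(\phi))'\phi(x)\,P(dx).$$ For $\mu\in\mathbb{R}^k$, $\Sigma$ symmetric positive definite and $\rho>0$, $E(\mu,\Sigma,\rho)=\{x\in\mathbb{R}^k:(x-\mu)'\Sigma^{-1}(x-\mu)\le\rho^2\}$, and $r_P(\phi)=\inf\{s>0:P(E(T_P(\phi),C_P(\phi),s))\ge\gamma\}$ (with $\inf\emptyset=+\infty$ and $E(\mu,\Sigma,+\infty)=\mathbb{R}^k$, which can only occur when $\gamma=1$). Under the hyperplane condition, $C_P(\phi)$ is positive definite for every $\phi\in K_P(\gamma)$. *)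

(* Defs.v *)
From HB Require Import structures.
From mathcomp Require Import all_boot all_order all_algebra.
From mathcomp Require Import all_classical all_reals all_analysis.

Set Implicit Arguments.
Unset Strict Implicit.
Unset Printing Implicit Defensive.

Import Order.TTheory GRing.Theory Num.Theory.
Import numFieldNormedType.Exports.

Local Open Scope classical_set_scope.
Local Open Scope ring_scope.

(* R^k is the type of column vectors, with the Borel sigma-algebra of its
   topology. *)
Notation Rk R k := (g_sigma_algebraType [set A : set 'cV[R]_k | open A]).

Definition boundary (T : topologicalType) (A : set T) : set T :=
  closure A `\` A°.

Definition affine_hyperplane (R : realType) (k : nat) (H : set 'cV[R]_k) :=
  exists (a : 'cV[R]_k) (b : R),
    a != 0 /\ H = [set x : 'cV[R]_k | (a^T *m x) 0 0 = b].

(* The library norm `|x| on matrices is the sup norm, hence this definition. *)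
Definition sq_norm (R : realType) (k : nat) (x : 'cV[R]_k) : R :=
  \sum_(i < k) x i 0 ^+ 2.

(* For rho = +oo this is the whole space, since +oo ^+ 2 = +oo. *)
Definition ellipsoid (R : realType) (k : nat) (mu : 'cV[R]_k) (Sigma : 'M[R]_k)
    (rho : \bar R) : set 'cV[R]_k :=
  [set x | ((((x - mu)^T *m invmx Sigma *m (x - mu)) 0 0)%:E <= rho ^+ 2)%E].

Section mcd.
Context (R : realType) (k : nat) (P : probability (Rk R k) R).
Implicit Types (gamma : R) (phi : Rk R k -> R).

Definition trimming_class gamma phi : Prop :=
  [/\ measurable_fun setT phi,
      (forall x, 0 <= phi x <= 1),
      (gamma%:E <= \int[P]_x (phi x)%:E)%E
    & (\int[P]_x (sq_norm x * phi x)%:E < +oo)%E].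

Definition trimmed_mass phi : R := \int[P]_x phi x.

Definition trimmed_mean phi : 'cV[R]_k :=
  \col_i ((trimmed_mass phi)^-1 * \int[P]_x ((x : 'cV[R]_k) i 0 * phi x)).

Definition trimmed_cov phi : 'M[R]_k :=
  let T := trimmed_mean phi in
  \matrix_(i, j) ((trimmed_mass phi)^-1 *
    \int[P]_x (((x - T) *m (x - T)^T) i j * phi x)).

Definition mcd_minimizer gamma phi : Prop :=
  trimming_class gamma phi /\
  forall psi, trimming_class gamma psi ->
    \det (trimmed_cov phi) <= \det (trimmed_cov psi).

Definition mcd_radius gamma phi : \bar R :=
  ereal_inf [set s%:E | s in [set s : R | 0 < s /\
    (gamma%:E <= P (ellipsoid (trimmed_mean phi) (trimmed_cov phi) s%:E))%E]].

Definition mcd_ellipsoid gamma phi : set 'cV[R]_k :=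
  ellipsoid (trimmed_mean phi) (trimmed_cov phi) (mcd_radius gamma phi).

End mcd.

(* Main.v *)
Require Import Defs.
From HB Require Import structures.
From mathcomp Require Import all_boot all_order all_algebra.
From mathcomp Require Import all_classical all_reals all_analysis.
From mathcomp Require Import measurable_realfun.
From mathcomp Require Import ring lra.

Set Implicit Arguments.
Unset Strict Implicit.
Unset Printing Implicit Defensive.

Import Order.TTheory GRing.Theory Num.Theory.
Import numFieldNormedType.Exports.

Local Open Scope classical_set_scope.
Local Open Scope ring_scope.

(* Let T, C be the barycentre and covariance of phi, and D(x) = (x-T)' C^-1 (x-T).
   For psi in the class, det C <= det C(psi) and AM-GM for C^-1 C(psi) give
   tr (C^-1 C(psi)) >= k; expanding around T, this says
     \int (D - k) psi dP >= 0, with equality only if psi has barycentre T,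
   while psi = phi gives equality. So no transfer of mass between phi and 1 - phi
   may decrease the integral of D: perturbing phi by subsets of its own mass
   shows \int phi = gamma (otherwise phi would live on a hyperplane), and
   exchanging mass across a level of D shows that phi is a cut at the
   gamma-quantile of D, which is r^2. Exchanges inside {D = r^2} keep the integral
   of D, hence must keep the barycentre, which forces the parts of phi and of
   1 - phi there to be carried by one common point unless one of them vanishes. *)

(** * Positive definite matrices *)

Section positive_definite.
Context (R : rcfType).

Definition quad_form n (M : 'M[R]_n) (u : 'cV[R]_n) : R :=
  (u^T *m M *m u) 0 0.

Definition posdef n (M : 'M[R]_n) :=
  M^T = M /\ forall u, u != 0 -> 0 < quad_form M u.

Lemma quad_form_delta n (M : 'M[R]_n) i :
  quad_form M (delta_mx i 0) = M i i.
Proof. by rewrite /quad_form trmx_delta -rowE -colE !mxE. Qed.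

Lemma posdef_diag_gt0 n (M : 'M[R]_n) i : posdef M -> 0 < M i i.
Proof.
move=> [_ Mpos]; rewrite -quad_form_delta; apply: Mpos; apply/eqP.
by move=> /matrixP/(_ i 0)/eqP; rewrite !mxE !eqxx oner_eq0.
Qed.

Lemma posdef_congr n (B M : 'M[R]_n) :
  B \in unitmx -> posdef M -> posdef (B *m M *m B^T).
Proof.
move=> Bu [Msym Mpos]; split; first by rewrite !trmx_mul trmxK Msym mulmxA.
move=> u u0; have -> : quad_form (B *m M *m B^T) u = quad_form M (B^T *m u).
  by rewrite /quad_form trmx_mul trmxK !mulmxA.
apply: Mpos; apply: contraNneq u0 => Bu0.
have BTu : B^T \in unitmx by rewrite unitmx_tr.
by rewrite -(mulKmx BTu u) Bu0 mulmx0.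
Qed.

Lemma posdef_ge0 n (M : 'M[R]_n) u : posdef M -> 0 <= quad_form M u.
Proof.
move=> [_ Mpos]; have [->|/Mpos/ltW//] := eqVneq u 0.
by rewrite /quad_form mulmx0 mxE.
Qed.

Lemma posdef_drsubmx m n (a : 'M[R]_m) (S : 'M[R]_n) :
  posdef (block_mx a 0 0 S) -> posdef S.
Proof.
move=> [sym pos]; split.
  by move: sym; rewrite tr_block_mx => /eq_block_mx[].
move=> u u0; have -> : quad_form S u = quad_form (block_mx a 0 0 S) (col_mx 0 u).
  rewrite /quad_form tr_col_mx mul_row_block mul_row_col.
  by rewrite !(mulmx0, mul0mx, trmx0, add0r, addr0).
by apply: pos; rewrite -(col_mx0 R m n 1); apply: contra_neq u0 => /eq_col_mx[].
Qed.

(** The Schur complement of the pivot [N 0 0] for a symmetric [N]: the transpose of the lower left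
    block stands for the upper right one. *)
Definition schur n (N : 'M[R]_(1 + n)) : 'M[R]_n :=
  drsubmx N - (N 0 0)^-1 *: (dlsubmx N *m (dlsubmx N)^T).

(** One step of Gaussian elimination: for a nonzero pivot, left multiplication by this unit
    triangular matrix clears the first column of [N] below the pivot. *)
Definition schur_elim n (N : 'M[R]_(1 + n)) : 'M[R]_(1 + n) :=
  block_mx 1%:M 0 (- (N 0 0)^-1 *: dlsubmx N) 1%:M.

Lemma det_schur_elim n (N : 'M[R]_(1 + n)) : \det (schur_elim N) = 1.
Proof. by rewrite det_lblock !det1 mulr1. Qed.

(** By symmetry, the transpose on the right clears the first row in the same way, and only the pivot
    and its Schur complement remain. *)
Lemma schur_congr n (N : 'M[R]_(1 + n)) : posdef N ->
  schur_elim N *m N *m (schur_elim N)^T = block_mx (N 0 0)%:M 0 0 (schur N).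
Proof.
move=> Npd; have a0 : N 0 0 != 0 by rewrite gt_eqF ?posdef_diag_gt0.
have [Nsym _] := Npd.
have ulE : ulsubmx N = (N 0 0)%:M.
  by rewrite [LHS]mx11_scalar !mxE !lshift0.
have urE : ursubmx N = (dlsubmx N)^T by rewrite trmx_dlsub Nsym.
have NE : N = block_mx (N 0 0)%:M (dlsubmx N)^T (dlsubmx N) (drsubmx N).
  by rewrite -{1}(submxK N) ulE urE.
rewrite /schur_elim /schur; move: (N 0 0) (dlsubmx N) (drsubmx N) a0 NE.
move=> a b S a0 ->; rewrite mulmx_block tr_block_mx mulmx_block.
rewrite !(mul1mx, mul0mx, mulmx0, mulmx1, addr0, add0r, trmx1, trmx0).
rewrite !linearZ /= !mul_mx_scalar !mul_scalar_mx -!scalemxAl.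
rewrite !scalerA mulrN divff// mulNr mulVf// !scaleN1r !addNr mul0mx.
by rewrite scaler0 add0r addrC scaleNr scalerN.
Qed.

Lemma schur_posdef n (N : 'M[R]_(1 + n)) : posdef N -> posdef (schur N).
Proof.
move=> Npd; apply: (@posdef_drsubmx 1 n (N 0 0)%:M); rewrite -schur_congr//.
by apply: posdef_congr => //; rewrite unitmxE det_schur_elim unitr1.
Qed.

(** Hadamard's inequality, by induction on the size: elimination factors the pivot out of the
    determinant, and the diagonal of the Schur complement is that of [N] minus squares divided by
    the pivot. *)
Lemma posdef_det_gt0_le_diag n (N : 'M[R]_n) : posdef N ->
  0 < \det N <= \prod_i N i i.
Proof.
elim: n N => [N _|n IHn N Npd]; first by rewrite det_mx00 big_ord0 ltr01 lexx.
have a0 : 0 < N 0 0 by exact: posdef_diag_gt0.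
have detE : \det N = N 0 0 * \det (schur N).
  rewrite -[N 0 0 in RHS](det_scalar1) -(@det_ublock _ 1 n _ 0) -schur_congr//.
  by rewrite !det_mulmx det_tr det_schur_elim mul1r mulr1.
have Spd := schur_posdef Npd; have /andP[S0 Sle] := IHn _ Spd.
rewrite detE mulr_gt0//= big_ord_recl ler_pM2l//; apply: le_trans Sle _.
apply: ler_prod => i _; rewrite ltW ?posdef_diag_gt0//=.
rewrite !mxE big_ord1 !mxE rshift1 lerBlDr lerDl mulr_ge0 ?invr_ge0 ?(ltW a0)//.
by rewrite -expr2 sqr_ge0.
Qed.

(** Elimination splits off the pivot, which its square root scales to 1; the induction treats the
    Schur complement. The matrix [A] so built is the inverse of a Cholesky factor. *)
Lemma posdef_cholesky n (C : 'M[R]_n) : posdef C ->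
  exists A : 'M[R]_n, A *m C *m A^T = 1%:M.
Proof.
elim: n C => [C _|n IHn C Cpd].
  by exists 0; apply/matrixP => -[].
have a0 : 0 < C 0 0 by exact: posdef_diag_gt0.
have [B BE] := IHn _ (schur_posdef Cpd).
pose G : 'M[R]_(1 + n) := block_mx (Num.sqrt (C 0 0))^-1%:M 0 0 B.
exists (G *m schur_elim C).
have -> : G *m schur_elim C *m C *m (G *m schur_elim C)^T =
          G *m (schur_elim C *m C *m (schur_elim C)^T) *m G^T.
  by rewrite trmx_mul !mulmxA.
rewrite schur_congr// tr_block_mx !mulmx_block.
rewrite !(mulmx0, mul0mx, trmx0, addr0, add0r) BE tr_scalar_mx -!scalar_mxM.
apply: etrans (esym (@scalar_mx_block _ 1 n 1)).
congr (block_mx _%:M _ _ _).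
have s0 : Num.sqrt (C 0 0) != 0 by rewrite sqrtr_eq0 -ltNge.
by rewrite -{2}[C 0 0]sqr_sqrtr ?(ltW a0)// expr2 mulrA mulVf ?mul1r ?divff.
Qed.

Lemma posdef_cholesky_unit n (A C : 'M[R]_n) : A *m C *m A^T = 1%:M ->
  A \in unitmx /\ C \in unitmx.
Proof. by have := unitmx1 R n => /[swap] <-; rewrite !unitmx_mul => /andP[/andP[]]. Qed.

(** The inverse is congruent to [C] through itself, since [C] is symmetric. *)
Lemma posdef_invmx n (C : 'M[R]_n) : posdef C -> posdef (invmx C).
Proof.
move=> Cpd; have [Csym _] := Cpd.
have [A /posdef_cholesky_unit[_ Cu]] := posdef_cholesky Cpd.
have -> : invmx C = invmx C *m C *m (invmx C)^T.
  by rewrite mulVmx// mul1mx trmx_inv Csym.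
by apply: posdef_congr => //; rewrite unitmx_inv.
Qed.

Lemma quad_formBZ n (M : 'M[R]_n) (u v : 'cV[R]_n) t : M^T = M ->
  quad_form M (u - t *: v) =
  quad_form M u - t * ((v^T *m M *m u) 0 0 *+ 2) + t ^+ 2 * quad_form M v.
Proof.
move=> Msym; have uv : (u^T *m M *m v) 0 0 = (v^T *m M *m u) 0 0.
  have -> : u^T *m M *m v = (v^T *m M *m u)^T.
    by rewrite !trmx_mul trmxK Msym mulmxA.
  by rewrite mxE.
have trB : (u - t *: v)^T = u^T - t *: v^T by rewrite linearB linearZ.
rewrite /quad_form trB !mulmxBl !mulmxBr.
rewrite -!scalemxAl -!scalemxAr; move: uv.
move: (u^T *m M *m u) (u^T *m M *m v) (v^T *m M *m u) (v^T *m M *m v).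
by move=> a b c d bc; rewrite !mxE bc; ring.
Qed.

(* Nonnegativity of [quad_form (invmx C) (y - t *: C e_i)] at its minimizing [t]. *)
Lemma coord_sqr_le_quad_form n (C : 'M[R]_n) (y : 'cV[R]_n) i : posdef C ->
  y i 0 ^+ 2 <= C i i * quad_form (invmx C) y.
Proof.
move=> Cpd; have [Csym _] := Cpd.
have [A /posdef_cholesky_unit[_ Cu]] := posdef_cholesky Cpd.
have [Qsym _] := posdef_invmx Cpd.
pose e : 'cV[R]_n := delta_mx i 0; pose t := y i 0 / C i i.
have Cii : 0 < C i i by exact: posdef_diag_gt0.
have : 0 <= quad_form (invmx C) (y - t *: (C *m e)).
  exact/posdef_ge0/posdef_invmx.
have eC : (C *m e)^T *m invmx C = e^T by rewrite trmx_mul Csym -mulmxA mulmxV// mulmx1.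
rewrite quad_formBZ// [quad_form _ (C *m e)]/quad_form eC mulmxA.
rewrite -[(e^T *m C *m e) 0 0]/(quad_form C e) quad_form_delta trmx_delta -rowE mxE.
have -> : t ^+ 2 * C i i = t * y i 0 by rewrite /t; field; rewrite gt_eqF.
rewrite mulr2n mulrDr => h.
have : t * y i 0 <= quad_form (invmx C) y by lra.
by rewrite /t mulrAC ler_pdivrMr// -expr2 mulrC.
Qed.

(* After a congruence reducing [C] to the identity, this is Hadamard's
   inequality followed by AM-GM on the diagonal. *)
Lemma posdef_trace_ge n (C M : 'M[R]_n) : (0 < n)%N ->
  posdef C -> posdef M -> \det C <= \det M -> n%:R <= \tr (invmx C *m M).
Proof.
move=> n0 Cpd Mpd CM; have [A AE] := posdef_cholesky Cpd.
have [Au Cu] := posdef_cholesky_unit AE.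
have Cinv : invmx C = A^T *m A.
  have CA : C *m (A^T *m A) = 1%:M.
    by rewrite mulmxA; apply: mulmx1C; rewrite mulmxA.
  by rewrite -(mulKmx Cu (A^T *m A)) CA mulmx1.
have -> : \tr (invmx C *m M) = \tr (A *m M *m A^T).
  by rewrite Cinv -[in LHS]mulmxA mxtrace_mulC.
have Npd : posdef (A *m M *m A^T) by exact: posdef_congr.
have det1le : 1 <= \det (A *m M *m A^T).
  rewrite -(det1 R n) -AE !det_mulmx det_tr -!mulrA [leRHS]mulrCA [leLHS]mulrCA.
  by rewrite ler_wpM2r// -expr2 sqr_ge0.
have /andP[_ detle] := posdef_det_gt0_le_diag Npd.
set N := A *m M *m A^T in Npd detle det1le *.
have AGM : \prod_i N i i <= (\tr N / n%:R) ^+ n.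
  have /leif_AGM : {in 'I_n, forall i, 0 <= N i i}.
    by move=> i _; rewrite ltW ?posdef_diag_gt0.
  by rewrite card_ord => -[].
have : 1 <= \tr N / n%:R.
  rewrite -(@ler_pXn2r _ n)// ?nnegrE ?ler01//.
    by rewrite expr1n (le_trans det1le)// (le_trans detle).
  rewrite divr_ge0 ?ler0n// sumr_ge0// => i _.
  by rewrite ltW ?posdef_diag_gt0.
by rewrite ler_pdivlMr ?ltr0n// mul1r.
Qed.

End positive_definite.
(** * Integrals against weights of finite second moment *)

Section vanishing_integral.
Context d (T : measurableType d) (R : realType) (P : {measure set T -> \bar R}).
Implicit Types (f : T -> R) (U : set T).

Lemma Rintegral_eq0_ae f : P.-integrable setT (EFin \o f) ->
  (forall x, 0 <= f x) -> \int[P]_x f x = 0 -> {ae P, forall x, f x = 0}.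
Proof.
move=> fint f0 If0.
have /integrableP[mf _] := fint.
have : (\int[P]_x `|(EFin \o f) x| = 0)%E.
  under eq_integral => x _ do rewrite gee0_abs ?lee_fin//.
  rewrite -[LHS]fineK; last exact: integrable_fin_num.
  by move: If0; rewrite /Rintegral /= => ->.
move/ae_eq_integral_abs => /(_ measurableT mf); apply: filterS => x /(_ I).
by case.
Qed.

(** Testing on the set where [f] is nonnegative and on its complement yields the integral of the
    absolute value of [f]. *)
Lemma Rintegral_indic_eq0_ae f : P.-integrable setT (EFin \o f) ->
  (forall U, measurable U -> \int[P]_x (f x * \1_U x) = 0) ->
  {ae P, forall x, f x = 0}.
Proof.
move=> fint If0.
have /integrableP[/measurable_EFinP mf _] := fint.
pose U := [set x | 0 <= f x].
have mU : measurable U.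
  by rewrite -[U]setTI; apply: measurable_fun_le => //; exact: measurable_cst.
have iU V : measurable V -> P.-integrable setT (EFin \o (fun x => f x * \1_V x)).
  move=> mV; apply: (le_integrable measurableT _ _ fint).
    by apply/measurable_EFinP; apply: measurable_funM => //; exact: measurable_indic.
  move=> x _; rewrite lee_fin normrM ler_piMr// indicE.
  by case: (x \in V); rewrite ?normr0 ?normr1.
have fE x : `|f x| = f x * \1_U x - f x * \1_(~` U) x.
  rewrite !indicE in_setC; case: (boolP (x \in U)) => /= [|/negP].
    by rewrite inE /U /= => fx; rewrite ger0_norm// mulr1 mulr0 subr0.
  rewrite inE /U /= => /negP; rewrite -ltNge => fx.
  by rewrite ltr0_norm// mulr0 mulr1 sub0r.
have : {ae P, forall x, `|f x| = 0}.
  apply: Rintegral_eq0_ae => //; first exact: integrable_norm.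
  under eq_Rintegral => x _ do rewrite fE.
  have mCU : measurable (~` U) by exact: measurableC.
  rewrite RintegralB//; [|exact: iU|exact: iU].
  by rewrite !If0// subr0.
by apply: filterS => x /eqP; rewrite normr_eq0 => /eqP.
Qed.
End vanishing_integral.

(** * Functions of at most quadratic growth *)

Section quadratic_growth.
Context (R : realType) (k : nat).
Implicit Types (f : Rk R k -> R).

Lemma measurable_continuous f :
  continuous (f : 'cV[R]_k -> R) -> measurable_fun setT f.
Proof.
move=> /continuousP cf; apply: (measurability _ (RGenOpens.measurableE R)).
move=> _ [_ [a [b ->] <-]]; rewrite setTI; apply: sub_sigma_algebra => /=.
exact/cf/interval_open.
Qed.

Lemma measurable_coord i :
  measurable_fun setT (fun x : Rk R k => (x : 'cV[R]_k) i 0).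
Proof. by apply: measurable_continuous; exact: coord_continuous. Qed.

(** The growth that a finite second moment makes integrable; the summand [1] makes room for
    constants and coordinates. *)
Definition quad_growth f := measurable_fun setT f /\
  exists K : R, forall x, `|f x| <= K * (1 + sq_norm x).

Lemma sq_norm_ge0 (x : 'cV[R]_k) : 0 <= sq_norm x.
Proof. by apply: sumr_ge0 => i _; exact: sqr_ge0. Qed.

Lemma coord_sqr_le (x : 'cV[R]_k) i : x i 0 ^+ 2 <= sq_norm x.
Proof. by rewrite /sq_norm (bigD1 i)//= lerDl sumr_ge0// => j _; exact: sqr_ge0. Qed.

Lemma quad_growth_cst (c : R) : quad_growth (fun=> c).
Proof.
split; first exact: measurable_cst.
by exists `|c| => x; rewrite ler_peMr// lerDl sq_norm_ge0.
Qed.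

Lemma quad_growthD f g :
  quad_growth f -> quad_growth g -> quad_growth (fun x => f x + g x).
Proof.
move=> [mf [K Kf]] [mg [L Lg]]; split; first exact: measurable_funD.
exists (K + L) => x; rewrite mulrDl; apply: le_trans (ler_normD _ _) _.
exact: lerD.
Qed.

Lemma quad_growthZ (c : R) f : quad_growth f -> quad_growth (fun x => c * f x).
Proof.
move=> [mf [K Kf]]; split; first exact: measurable_funM.
by exists (`|c| * K) => x; rewrite normrM -mulrA ler_wpM2l.
Qed.

Lemma quad_growth_sum (I : finType) (F : I -> Rk R k -> R) :
  (forall i, quad_growth (F i)) -> quad_growth (fun x => \sum_i F i x).
Proof.
move=> qF; have -> : (fun x => \sum_i F i x) = \sum_i F i.
  by apply/funext => x; rewrite fct_sumE.
elim/big_ind: _ => //; first exact: quad_growth_cst.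
by move=> f g qf qg; exact: quad_growthD.
Qed.

Lemma quad_growth_coord i : quad_growth (fun x => (x : 'cV[R]_k) i 0).
Proof.
split; first exact: measurable_coord.
exists 1 => x; rewrite mul1r; have := coord_sqr_le x i.
by rewrite ler_norml => ?; apply/andP; split; nra.
Qed.

Lemma quad_growth_coordM i j :
  quad_growth (fun x => (x : 'cV[R]_k) i 0 * (x : 'cV[R]_k) j 0).
Proof.
split; first by apply: measurable_funM; exact: measurable_coord.
exists 1 => x; rewrite mul1r; have := coord_sqr_le x i; have := coord_sqr_le x j.
by rewrite ler_norml => ? ?; apply/andP; split; nra.
Qed.

Lemma quad_growth_sq_norm : quad_growth (@sq_norm R k).
Proof. by apply: quad_growth_sum => i; exact: quad_growth_coordM. Qed.

Lemma quad_growthB f g :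
  quad_growth f -> quad_growth g -> quad_growth (fun x => f x - g x).
Proof.
move=> qf qg; have -> : (fun x => f x - g x) = (fun x => f x + (-1) * g x).
  by apply/funext => x; rewrite mulN1r.
by apply: quad_growthD => //; exact: quad_growthZ.
Qed.

Lemma quad_growth_affM i j (a b : R) :
  quad_growth (fun x => ((x : 'cV[R]_k) i 0 - a) * ((x : 'cV[R]_k) j 0 - b)).
Proof.
have -> : (fun x : Rk R k => ((x : 'cV[R]_k) i 0 - a) * ((x : 'cV[R]_k) j 0 - b)) =
    fun x => ((x : 'cV[R]_k) i 0 * (x : 'cV[R]_k) j 0 +
             (- a) * (x : 'cV[R]_k) j 0) + ((- b) * (x : 'cV[R]_k) i 0 + a * b).
  by apply/funext => x; ring.
apply: quad_growthD; apply: quad_growthD.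
- exact: quad_growth_coordM.
- exact/quad_growthZ/quad_growth_coord.
- exact/quad_growthZ/quad_growth_coord.
- exact: quad_growth_cst.
Qed.

End quadratic_growth.

(** * Weights and the integrals against them *)

Section weights.
Context (R : realType) (k : nat) (P : probability (Rk R k) R).
Implicit Types (f g : Rk R k -> R) (U : set (Rk R k)).

Lemma ae_imp (A B : Rk R k -> Prop) : (forall x, A x -> B x) ->
  {ae P, forall x, A x} -> {ae P, forall x, B x}.
Proof. by move=> AB [N [mN N0 AN]]; exists N; split => // x nB; apply: AN => /AB. Qed.

(** [trimming_class] without its lower bound on the mass, so that the parts of [phi] and of
    [1 - phi] that get exchanged are covered too. *)
Definition weight g := [/\ measurable_fun setT g, (forall x, 0 <= g x <= 1) &
  (\int[P]_x (sq_norm x * g x)%:E < +oo)%E].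

(** The mass of [g] is the case of the constant 1, so one set of linearity lemmas serves masses,
    barycentres and integrals of the distance. *)
Definition wint g f : R := \int[P]_x (f x * g x).

Lemma trimming_classE gamma g :
  trimming_class P gamma g <-> weight g /\ (gamma%:E <= \int[P]_x (g x)%:E)%E.
Proof. by split=> [[? ? ? ?]|[[? ? ?] ?]]; do !split. Qed.

(** Domination by [K * (g x + sq_norm x * g x)]: the first term is bounded under a probability, the
    second has a finite integral by assumption. *)
Lemma integrable_wint g f : weight g -> quad_growth f ->
  P.-integrable setT (EFin \o (fun x => f x * g x)).
Proof.
move=> [mg g01 ig] [mf [K Kf]].
have g0 x : 0 <= g x by have /andP[] := g01 x.
have i1 : P.-integrable setT (EFin \o g).
  apply: (le_integrable measurableT _ _ (finite_measure_integrable_cst P 1 measurableT)).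
    exact/measurable_EFinP.
  by move=> x _; rewrite lee_fin normr1 ger0_norm//; have /andP[] := g01 x.
have i2 : P.-integrable setT (EFin \o (fun x => sq_norm x * g x)).
  apply/integrableP; split.
    apply/measurable_EFinP; apply: measurable_funM => //.
    by have [] := @quad_growth_sq_norm R k.
  under eq_integral => x _ do rewrite gee0_abs ?lee_fin ?mulr_ge0 ?sq_norm_ge0//.
  exact: ig.
have i3 := integrableZl measurableT K (integrableD measurableT i1 i2).
apply: (le_integrable measurableT _ _ i3).
  by apply/measurable_EFinP; exact: measurable_funM.
move=> x _; rewrite [leRHS](_ : _ = `|K * (g x + sq_norm x * g x)|%:E)//.
rewrite lee_fin normrM (ger0_norm (g0 x)).
apply: le_trans (ler_norm _).
have -> : K * (g x + sq_norm x * g x) = K * (1 + sq_norm x) * g x by ring.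
by rewrite ler_wpM2r.
Qed.

Lemma weight_ge0 g x : weight g -> 0 <= g x.
Proof. by move=> [_ /(_ x)/andP[]]. Qed.

Lemma weight_le1 g x : weight g -> g x <= 1.
Proof. by move=> [_ /(_ x)/andP[]]. Qed.

Lemma wint_ge0 g f : (forall x, 0 <= f x * g x) -> 0 <= wint g f.
Proof. by move=> fg0; apply: Rintegral_ge0. Qed.

Lemma wintD g f1 f2 : weight g -> quad_growth f1 -> quad_growth f2 ->
  wint g (fun x => f1 x + f2 x) = wint g f1 + wint g f2.
Proof.
move=> wg q1 q2; rewrite /wint -RintegralD//; try exact: integrable_wint.
by under eq_Rintegral => x _ do rewrite mulrDl.
Qed.

Lemma wintZ g c f : weight g -> quad_growth f ->
  wint g (fun x => c * f x) = c * wint g f.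
Proof.
move=> wg q; rewrite /wint -RintegralZl//; last exact: integrable_wint.
by under eq_Rintegral => x _ do rewrite -mulrA.
Qed.

Lemma wintB g f1 f2 : weight g -> quad_growth f1 -> quad_growth f2 ->
  wint g (fun x => f1 x - f2 x) = wint g f1 - wint g f2.
Proof.
move=> wg q1 q2; rewrite /wint -RintegralB//; try exact: integrable_wint.
by under eq_Rintegral => x _ do rewrite mulrBl.
Qed.

Lemma wint_sum g (I : finType) (F : I -> Rk R k -> R) : weight g ->
  (forall i, quad_growth (F i)) ->
  wint g (fun x => \sum_i F i x) = \sum_i wint g (F i).
Proof.
move=> wg qF.
have -> : (fun x => \sum_i F i x) = \sum_i F i.
  by apply/funext => x; rewrite fct_sumE.
(* The growth of the partial sums is carried along with the equality, because additivity of the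
   integral asks for it. *)
have [] // : quad_growth (\sum_i F i) /\ wint g (\sum_i F i) = \sum_i wint g (F i).
apply: (big_rec2 (fun f s => quad_growth f /\ wint g f = s)).
  split; first exact: quad_growth_cst.
  rewrite /wint; under eq_Rintegral => x _ do rewrite mul0r.
  by rewrite Rintegral_cst// mul0r.
move=> i f _ _ [qf <-]; split; first exact: quad_growthD.
by rewrite -wintD.
Qed.

Lemma wint_cst g c : weight g -> wint g (fun=> c) = c * wint g (fun=> 1).
Proof.
move=> wg; rewrite -wintZ//; last exact: quad_growth_cst.
by under [in RHS]eq_fun do rewrite mulr1.
Qed.

Lemma weight_le g g' : weight g -> measurable_fun setT g' ->
  (forall x, 0 <= g' x <= g x) -> weight g'.
Proof.
move=> [mg g01 ig] mg' g'01; split => //.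
  move=> x; have /andP[-> /le_trans->//] := g'01 x.
  by have /andP[] := g01 x.
apply: le_lt_trans ig; apply: ge0_le_integral => //.
- move=> x _; rewrite lee_fin mulr_ge0 ?sq_norm_ge0//.
  by have /andP[] := g'01 x.
- apply/measurable_EFinP/measurable_funM => //.
  by have [] := @quad_growth_sq_norm R k.
- apply/measurable_EFinP/measurable_funM => //.
  by have [] := @quad_growth_sq_norm R k.
- move=> x _; rewrite lee_fin ler_wpM2l ?sq_norm_ge0//.
  by have /andP[] := g'01 x.
Qed.

(** Meant for [1 - phi], whose second moment may be infinite: cut down to a bounded set, it becomes
    a weight. *)
Lemma weight_bounded g K : measurable_fun setT g -> (forall x, 0 <= g x <= 1) ->
  0 <= K -> (forall x, g x != 0 -> sq_norm x <= K) -> weight g.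
Proof.
move=> mg g01 K0 gK; split => //; apply: (@le_lt_trans _ _ (\int[P]_x (cst K%:E x))%E).
  apply: ge0_le_integral => //.
  - move=> x _; rewrite lee_fin mulr_ge0 ?sq_norm_ge0//.
    by have /andP[] := g01 x.
  - apply/measurable_EFinP/measurable_funM => //.
    by have [] := @quad_growth_sq_norm R k.
  - move=> x _ /=; rewrite lee_fin; have [->|/gK xK] := eqVneq (g x) 0.
      by rewrite mulr0.
    apply: le_trans xK; rewrite ler_piMr ?sq_norm_ge0//.
    by have /andP[] := g01 x.
exact: (integrable_lty measurableT (finite_measure_integrable_cst P K measurableT)).
Qed.

Lemma weight_indic g U : weight g -> measurable U ->
  weight (fun x => g x * \1_U x).
Proof.
move=> wg mU; apply: (weight_le wg).
  by apply: measurable_funM; [case: wg|exact: measurable_indic].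
have [_ g01 _] := wg.
move=> x; have /andP[g0 _] := g01 x; rewrite indicE.
by case: (x \in U); rewrite ?mulr1 ?mulr0 ?g0 lexx.
Qed.

Lemma weightZ g c : weight g -> 0 <= c <= 1 -> weight (fun x => c * g x).
Proof.
move=> wg /andP[c0 c1]; apply: (weight_le wg).
  by apply: measurable_funM => //; case: wg.
have [_ g01 _] := wg.
move=> x; have /andP[g0 _] := g01 x.
by rewrite mulr_ge0//= ler_piMl.
Qed.

(** The admissible perturbations of [g]: [g1] fills room left below 1 and [g2] is taken out of [g],
    so the values stay between 0 and 1. *)
Lemma weightDB g g1 g2 : weight g -> weight g1 -> weight g2 ->
  (forall x, g1 x <= 1 - g x) -> (forall x, g2 x <= g x) ->
  weight (fun x => g x + g1 x - g2 x).
Proof.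
move=> wg wg1 wg2 g1le g2le.
have [mg g01 _] := wg; have [mg1 g101 _] := wg1; have [mg2 g201 _] := wg2.
split.
- by apply: measurable_funB => //; exact: measurable_funD.
- move=> x; have /andP[? ?] := g01 x; have /andP[? ?] := g101 x.
  have /andP[? ?] := g201 x; have := g1le x; have := g2le x.
  by move=> ? ?; apply/andP; split; lra.
- have qs := @quad_growth_sq_norm R k.
  have i := integrableB measurableT (integrableD measurableT
    (integrable_wint wg qs) (integrable_wint wg1 qs)) (integrable_wint wg2 qs).
  under eq_integral => x _ do rewrite mulrBr mulrDr EFinB EFinD.
  have := integrable_lty measurableT i; apply.
Qed.

Lemma wintDB g g1 g2 f : weight g -> weight g1 -> weight g2 -> quad_growth f ->
  wint (fun x => g x + g1 x - g2 x) f = wint g f + wint g1 f - wint g2 f.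
Proof.
move=> wg wg1 wg2 qf; rewrite /wint.
under eq_Rintegral => x _ do rewrite mulrBr mulrDr.
rewrite RintegralB//; [|exact: (integrableD measurableT (integrable_wint wg qf)
  (integrable_wint wg1 qf))|exact: integrable_wint].
by rewrite RintegralD//; exact: integrable_wint.
Qed.

Lemma wintZw g c f : weight g -> quad_growth f ->
  wint (fun x => c * g x) f = c * wint g f.
Proof.
move=> wg qf; rewrite -wintZ// /wint.
by under eq_Rintegral => x _ do rewrite mulrCA mulrA.
Qed.

Lemma wint_setC g U f : weight g -> quad_growth f -> measurable U ->
  wint (fun x => g x * \1_U x) f + wint (fun x => g x * \1_(~` U) x) f = wint g f.
Proof.
move=> wg qf mU; rewrite /wint -RintegralD//; first last.
- by apply: integrable_wint => //; apply: weight_indic => //; exact: measurableC.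
- by apply: integrable_wint => //; exact: weight_indic.
apply: eq_Rintegral => x _; rewrite !indicE in_setC.
by case: (x \in U) => /=; ring.
Qed.

Lemma wint_eq0_ae g f : weight g -> quad_growth f ->
  (forall x, 0 <= f x * g x) ->
  wint g f = 0 -> {ae P, forall x, f x * g x = 0}.
Proof. by move=> wg qf f0; apply: Rintegral_eq0_ae => //; exact: integrable_wint. Qed.

Lemma wint_indic_eq0_ae g f : weight g -> quad_growth f ->
  (forall U, measurable U -> wint (fun x => g x * \1_U x) f = 0) ->
  {ae P, forall x, f x * g x = 0}.
Proof.
move=> wg qf wU; apply: Rintegral_indic_eq0_ae; first exact: integrable_wint.
move=> U mU; rewrite -[RHS](wU U mU) /wint.
by apply: eq_Rintegral => x _; rewrite mulrA.
Qed.

End weights.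

(** * Continuity of finite sums and measurability of level sets *)

Lemma continuous_sum (T : topologicalType) (R : realType) (I : finType)
    (f : I -> T -> R) :
  (forall i, continuous (f i)) -> continuous (fun x => \sum_i f i x).
Proof.
move=> cf; have -> : (fun x => \sum_i f i x) = \sum_i f i.
  by apply/funext => x; rewrite fct_sumE.
elim/big_ind: _ => //; first by move=> x; exact: cvg_cst.
by move=> g h cg ch x; apply: cvgD; [exact: cg|exact: ch].
Qed.

Section level_sets.
Context d (T : measurableType d) (R : realType) (f : T -> R).
Context (mf : measurable_fun setT f).

Lemma measurable_le_cst c : measurable [set x | f x <= c].
Proof.
by rewrite -[X in measurable X]setTI; apply: measurable_fun_le => //;
  exact: measurable_cst.
Qed.

Lemma measurable_lt_cst c : measurable [set x | f x < c].
Proof.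
have -> : [set x | f x < c] = ~` (setT `&` [set x | c <= f x]).
  apply/seteqP; split => x /=; rewrite ltNge; first by move=> /negP fc [].
  by move=> fc; apply/negP => cf; exact: fc.
by apply: measurableC; apply: measurable_fun_le => //; exact: measurable_cst.
Qed.

Lemma measurable_eq_cst c : measurable [set x | f x = c].
Proof.
have -> : [set x | f x = c] = [set x | f x <= c] `\` [set x | f x < c].
  apply/seteqP; split => x /= => [->|]; first by rewrite lexx ltxx.
  by move=> [fc /negP]; rewrite -leNgt => cf; apply/eqP; rewrite eq_le fc.
by apply: measurableD; [exact: measurable_le_cst|exact: measurable_lt_cst].
Qed.
End level_sets.

(** * First and second moments *)

Section moments.
Context (R : realType) (k : nat) (P : probability (Rk R k) R).
Implicit Types (f g : Rk R k -> R) (U : set (Rk R k)).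

Local Notation mass g := (wint P g (fun=> 1)).

Lemma massE g : weight P g -> (\int[P]_x (g x)%:E)%E = (mass g)%:E.
Proof.
move=> wg; rewrite /wint /Rintegral.
under [in RHS]eq_integral => x _ do rewrite mul1r.
rewrite fineK//; apply: integrable_fin_num => //.
have := integrable_wint wg (quad_growth_cst k 1).
by apply: eq_integrable => // x _ /=; rewrite mul1r.
Qed.

Lemma quad_formE n (Q : 'M[R]_n) (u : 'cV[R]_n) :
  quad_form Q u = \sum_i \sum_j Q i j * (u i 0 * u j 0).
Proof.
rewrite /quad_form -mulmxA mxE; apply: eq_bigr => i _.
rewrite !mxE big_distrr/=; apply: eq_bigr => j _; ring.
Qed.

Lemma quad_growth_form (Q : 'M[R]_k) (c : 'cV[R]_k) :
  quad_growth (fun x => quad_form Q ((x : 'cV[R]_k) - c)).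
Proof.
under eq_fun => x do rewrite quad_formE.
apply: quad_growth_sum => i; apply: quad_growth_sum => j; apply: quad_growthZ.
by under eq_fun => x do rewrite !mxE; exact: quad_growth_affM.
Qed.

Lemma trimmed_massE g : trimmed_mass P g = mass g.
Proof. by apply: eq_Rintegral => x _; rewrite mul1r. Qed.

Lemma wint_coordB g i c : weight P g -> 0 < mass g ->
  wint P g (fun x => (x : 'cV[R]_k) i 0 - c) =
  mass g * (trimmed_mean P g i 0 - c).
Proof.
move=> wg m0; rewrite wintB//; [|exact: quad_growth_coord|exact: quad_growth_cst].
rewrite wint_cst// !mxE trimmed_massE mulrBr mulrA mulfV ?gt_eqF// mul1r.
by rewrite (mulrC c).
Qed.

(** The parallel axis identity: after expansion around the barycentre [T], the term linear in
    [x i 0 - T i 0] integrates to 0. *)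
Lemma wint_coordBM g i j a b : weight P g -> 0 < mass g ->
  wint P g (fun x => ((x : 'cV[R]_k) i 0 - a) * ((x : 'cV[R]_k) j 0 - b)) =
  mass g * (trimmed_cov P g i j +
            (trimmed_mean P g i 0 - a) * (trimmed_mean P g j 0 - b)).
Proof.
move=> wg m0; set T := trimmed_mean P g.
have qi := @quad_growth_coord R k i; have qj := @quad_growth_coord R k j.
have qc c : @quad_growth R k (fun=> c) by exact: quad_growth_cst.
have qA := quad_growth_affM i j (T i 0) (T j 0).
have -> : (fun x : Rk R k => ((x : 'cV[R]_k) i 0 - a) * ((x : 'cV[R]_k) j 0 - b)) =
  fun x => ((x : 'cV[R]_k) i 0 - T i 0) * ((x : 'cV[R]_k) j 0 - T j 0) +
    ((T j 0 - b) * ((x : 'cV[R]_k) i 0 - T i 0) +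
     (T i 0 - a) * ((x : 'cV[R]_k) j 0 - b)).
  by apply/funext => x; ring.
have qBi : quad_growth (fun x => (x : 'cV[R]_k) i 0 - T i 0) by exact: quad_growthB.
have qBj : quad_growth (fun x => (x : 'cV[R]_k) j 0 - b) by exact: quad_growthB.
rewrite wintD//; last by apply: quad_growthD; exact: quad_growthZ.
rewrite wintD//; [|exact: quad_growthZ|exact: quad_growthZ].
rewrite !wintZ// !wint_coordB// subrr mulr0 mulr0 add0r [RHS]mulrDr; congr (_ + _).
  rewrite [trimmed_cov P g i j]mxE trimmed_massE mulrA mulfV ?gt_eqF// mul1r /wint.
  by apply: eq_Rintegral => x _; rewrite [in RHS]mxE big_ord1 !mxE.
by rewrite mulrCA.
Qed.

(** Entrywise use of the parallel axis identity. As the covariance is symmetric, the double sum is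
    the trace of [Q *m trimmed_cov P g]. *)
Lemma wint_quad_form g (Q : 'M[R]_k) (c : 'cV[R]_k) : weight P g -> 0 < mass g ->
  wint P g (fun x => quad_form Q ((x : 'cV[R]_k) - c)) =
  mass g * (\sum_i \sum_j Q i j * trimmed_cov P g i j +
            quad_form Q (trimmed_mean P g - c)).
Proof.
move=> wg m0.
have q i j : quad_growth (fun x => Q i j * (((x : 'cV[R]_k) i 0 - c i 0) *
    ((x : 'cV[R]_k) j 0 - c j 0))).
  by apply: quad_growthZ; exact: quad_growth_affM.
have -> : (fun x : Rk R k => quad_form Q ((x : 'cV[R]_k) - c)) =
  fun x => \sum_i \sum_j Q i j * (((x : 'cV[R]_k) i 0 - c i 0) *
    ((x : 'cV[R]_k) j 0 - c j 0)).
  apply/funext => x; rewrite quad_formE; apply: eq_bigr => i _.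
  by apply: eq_bigr => j _; rewrite !mxE.
rewrite wint_sum//; last by move=> i; exact: quad_growth_sum.
rewrite quad_formE -big_split/= big_distrr/=; apply: eq_bigr => i _.
rewrite wint_sum// -big_split/= big_distrr/=; apply: eq_bigr => j _.
rewrite wintZ//; last exact: quad_growth_affM.
rewrite wint_coordBM// !mxE; ring.
Qed.

Lemma trimmed_cov_sym g : (trimmed_cov P g)^T = trimmed_cov P g.
Proof.
apply/matrixP => i j; rewrite !mxE; congr (_ * _); apply: eq_Rintegral => x _.
by rewrite !mxE !big_ord1 !mxE (mulrC (x j 0 - _)).
Qed.

(** Integration of [g <= \1_U], valid almost everywhere. A weight of mass at least [gamma] carried
    by a hyperplane thereby contradicts the hyperplane condition. *)
Lemma mass_le_supp g U : weight P g -> measurable U ->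
  {ae P, forall x, ~ U x -> g x = 0} -> ((mass g)%:E <= P U)%E.
Proof.
move=> wg mU gU; rewrite -massE//; have [mg g01 _] := wg.
rewrite -[P U](_ : (\int[P]_x (\1_U x)%:E = _)%E); last by rewrite integral_indic// setIT.
apply: ae_ge0_le_integral => //.
- by move=> x _; rewrite lee_fin; have /andP[] := g01 x.
- exact/measurable_EFinP.
- by apply/measurable_EFinP; exact: measurable_indic.
- apply: filterS gU => x gx _; rewrite lee_fin indicE.
  case: (boolP (x \in U)) => [_|/negP xU]; first by have /andP[] := g01 x.
  by rewrite gx// => Ux; apply: xU; rewrite inE.
Qed.

(** The product vanishes almost everywhere, hence so does [g], and the empty set supports it. *)
Lemma wint_eq0_mass g f : weight P g -> quad_growth f ->
  (forall x, 0 <= f x * g x) -> (forall x, f x * g x = 0 -> g x = 0) ->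
  wint P g f = 0 -> mass g = 0.
Proof.
move=> wg qf fg0 fg0' /(wint_eq0_ae wg qf fg0) aefg; apply/eqP; rewrite eq_le.
rewrite wint_ge0; last by move=> x; rewrite mul1r (weight_ge0 _ wg).
have : ((mass g)%:E <= P set0)%E.
  by apply: mass_le_supp => //; apply: filterS aefg => x /fg0' ->.
by rewrite measure0 lee_fin andbT.
Qed.

Lemma mass_eq0_ae g : weight P g -> mass g = 0 -> {ae P, forall x, g x = 0}.
Proof.
move=> wg; have g0 x : 0 <= 1 * g x by rewrite mul1r (weight_ge0 _ wg).
move=> /(wint_eq0_ae wg (quad_growth_cst k 1) g0).
by apply: filterS => x; rewrite mul1r.
Qed.

Lemma mass_ge0 g : weight P g -> 0 <= mass g.
Proof. by move=> wg; apply: wint_ge0 => x; rewrite mul1r (weight_ge0 _ wg). Qed.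

Lemma measurable_hyperplane (u : 'cV[R]_k) b :
  measurable ([set x | (u^T *m x) 0 0 = b] : set (Rk R k)).
Proof.
apply: (@measurable_eq_cst _ _ R (fun x : Rk R k => (u^T *m (x : 'cV[R]_k)) 0 0)).
rewrite (_ : (fun x => _) =
    fun x : Rk R k => \sum_i u i 0 * (x : 'cV[R]_k) i 0); last first.
  by apply/funext => x; rewrite mxE; apply: eq_bigr => i _; rewrite mxE.
by apply: measurable_sum => i; apply: measurable_funM => //; exact: measurable_coord.
Qed.

(** The form at [u] is the variance of [u^T *m x] under the normalized weight, obtained from the
    moment formula for the rank one matrix [u *m u^T]. If it were 0, [g] would live on a hyperplane
    orthogonal to [u]. *)
Lemma trimmed_cov_posdef gamma g : weight P g -> 0 < gamma -> gamma <= mass g ->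
  (forall H : set 'cV[R]_k, affine_hyperplane H -> (P H < gamma%:E)%E) ->
  posdef (trimmed_cov P g).
Proof.
move=> wg gamma0 gm hP; split; first exact: trimmed_cov_sym.
have m0 : 0 < mass g by exact: lt_le_trans gm.
move=> u u0; set T := trimmed_mean P g.
have wE : wint P g (fun x => quad_form (u *m u^T) ((x : 'cV[R]_k) - T)) =
    mass g * quad_form (trimmed_cov P g) u.
  rewrite wint_quad_form// subrr [quad_form _ 0]quad_formE.
  rewrite [X in _ + X]big1 ?addr0; last first.
    by move=> i _; apply: big1 => j _; rewrite !mxE mul0r mulr0.
  congr (_ * _); rewrite quad_formE; apply: eq_bigr => i _; apply: eq_bigr => j _.
  by rewrite mxE big_ord1 !mxE mulrC.
have qE x : quad_form (u *m u^T) (x - T) = ((u^T *m x) 0 0 - (u^T *m T) 0 0) ^+ 2.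
  have <- : (u^T *m (x - T)) 0 0 = (u^T *m x) 0 0 - (u^T *m T) 0 0.
    by rewrite mulmxBr !mxE.
  rewrite /quad_form mulmxA -mulmxA mxE big_ord1 expr2; congr (_ * _).
  by rewrite -[LHS]/(((x - T)^T *m u) 0 0) -[u in LHS]trmxK -trmx_mul mxE.
have q0 x : 0 <= quad_form (u *m u^T) (x - T) * g x.
  by rewrite qE mulr_ge0 ?sqr_ge0 ?(weight_ge0 _ wg).
have : 0 <= mass g * quad_form (trimmed_cov P g) u by rewrite -wE; exact: wint_ge0.
rewrite pmulr_rge0// le_eqVlt => /predU1P[/esym qu0|//]; exfalso.
have wE0 : wint P g (fun x => quad_form (u *m u^T) ((x : 'cV[R]_k) - T)) = 0.
  by rewrite wE qu0 mulr0.
pose b := (u^T *m T) 0 0.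
pose H : set (Rk R k) := [set x | (u^T *m x) 0 0 = b].
have /hP : affine_hyperplane H by exists u, b.
apply/negP; rewrite -leNgt; apply: (@le_trans _ _ (mass g)%:E).
  by rewrite lee_fin.
apply: mass_le_supp => //; first exact: measurable_hyperplane.
have := wint_eq0_ae wg (quad_growth_form _ _) q0 wE0.
apply: filterS => x; rewrite qE => /eqP; rewrite mulf_eq0 sqrf_eq0 subr_eq0.
by case/orP => /eqP.
Qed.

(* The trace inequality at [invmx (trimmed_cov P phi)] bounds the average of the
   squared Mahalanobis distance around the barycentre of [psi]; moving the
   centre to the barycentre of [phi] adds a term that vanishes only if the two
   barycentres agree. *)
Lemma mcd_first_order gamma phi psi : (0 < k)%N -> 0 < gamma ->
  (forall H : set 'cV[R]_k, affine_hyperplane H -> (P H < gamma%:E)%E) ->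
  weight P phi -> gamma <= mass phi -> weight P psi -> gamma <= mass psi ->
  \det (trimmed_cov P phi) <= \det (trimmed_cov P psi) ->
  let T := trimmed_mean P phi in
  let D (x : Rk R k) := quad_form (invmx (trimmed_cov P phi)) ((x : 'cV[R]_k) - T) in
  k%:R * mass psi <= wint P psi D /\
  (wint P psi D = k%:R * mass psi ->
   forall i, wint P psi (fun x => (x : 'cV[R]_k) i 0 - T i 0) = 0).
Proof.
move=> k0 gamma0 hP wphi gphi wpsi gpsi dets T D.
have mpsi0 : 0 < mass psi by exact: lt_le_trans gpsi.
have Cpd := trimmed_cov_posdef wphi gamma0 gphi hP.
have Mpd := trimmed_cov_posdef wpsi gamma0 gpsi hP.
have tr_ge := posdef_trace_ge k0 Cpd Mpd dets.
have Qpd := posdef_invmx Cpd.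
set Q := invmx _ in D tr_ge Qpd *.
have trE : \sum_i \sum_j Q i j * trimmed_cov P psi i j = \tr (Q *m trimmed_cov P psi).
  rewrite /mxtrace; apply: eq_bigr => i _; rewrite [RHS]mxE; apply: eq_bigr => j _.
  by rewrite -{1}(trimmed_cov_sym psi) [_^T i j]mxE.
rewrite /D wint_quad_form// trE; set S := trimmed_mean P psi.
have q0 : 0 <= quad_form Q (S - T) by exact: posdef_ge0.
split; first by rewrite mulrC ler_pM2l//; lra.
rewrite [RHS]mulrC => /(mulfI (lt0r_neq0 mpsi0)) trq i.
have ST : S = T.
  apply/eqP; rewrite -subr_eq0; apply/negPn/negP => /(proj2 Qpd).
  by move=> qpos; lra.
by rewrite wint_coordB// -/S ST subrr mulr0.
Qed.

End moments.
(** * Minimizers of the determinant *)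

Section minimizer.
Context (R : realType) (k : nat) (k0 : (0 < k)%N).
Context (gamma : R) (gamma0 : 0 < gamma).
Context (P : probability (Rk R k) R).
Context (hP : forall H : set 'cV[R]_k, affine_hyperplane H -> (P H < gamma%:E)%E).
Context (phi : Rk R k -> R) (hphi : mcd_minimizer P gamma phi).
Implicit Types (g : Rk R k -> R) (U V : set (Rk R k)).

Local Notation mass g := (wint P g (fun=> 1)).
Let T := trimmed_mean P phi.

(** The square of the Mahalanobis distance to [T], so that a radius [r] corresponds to the level
    [r ^+ 2]. *)
Definition mahalanobis (x : Rk R k) : R :=
  quad_form (invmx (trimmed_cov P phi)) ((x : 'cV[R]_k) - T).
Local Notation D := mahalanobis.

Lemma weight_phi : weight P phi.
Proof. by have [/trimming_classE[]] := hphi. Qed.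
Local Notation wphi := weight_phi.

Lemma mass_phi_ge : gamma <= mass phi.
Proof.
have [/trimming_classE[_]] := hphi.
by rewrite massE ?lee_fin//; exact: weight_phi.
Qed.

Lemma mass_phi_gt0 : 0 < mass phi.
Proof. exact: lt_le_trans mass_phi_ge. Qed.

Lemma cov_phi_posdef : posdef (trimmed_cov P phi).
Proof. exact: trimmed_cov_posdef wphi gamma0 mass_phi_ge hP. Qed.

Lemma mahalanobis_ge0 x : 0 <= D x.
Proof. exact/posdef_ge0/posdef_invmx/cov_phi_posdef. Qed.

Lemma quad_growth_mahalanobis : quad_growth D.
Proof. exact: quad_growth_form. Qed.
Local Notation qD := quad_growth_mahalanobis.

(** The trace is that of the identity and the centre is not shifted: [phi] attains equality in the
    first order bound. *)
Lemma wint_mahalanobis : wint P phi D = k%:R * mass phi.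
Proof.
rewrite /D wint_quad_form ?mass_phi_gt0//; last exact: wphi.
have [Csym _] := cov_phi_posdef.
have -> : \sum_i \sum_j invmx (trimmed_cov P phi) i j * trimmed_cov P phi i j =
    \tr (invmx (trimmed_cov P phi) *m trimmed_cov P phi).
  rewrite /mxtrace; apply: eq_bigr => i _; rewrite [RHS]mxE; apply: eq_bigr => j _.
  by rewrite -{2}Csym [_^T i j]mxE.
have [A /posdef_cholesky_unit[_ Cu]] := posdef_cholesky cov_phi_posdef.
by rewrite mulVmx// mxtrace1 subrr /quad_form mulmx0 mxE addr0 mulrC.
Qed.

Lemma wint_centred i : wint P phi (fun x => (x : 'cV[R]_k) i 0 - T i 0) = 0.
Proof.
by rewrite wint_coordB ?mass_phi_gt0 ?subrr ?mulr0//; exact: weight_phi.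
Qed.

(** Makes the sublevel sets of [D] bounded. Each coordinate satisfies
    [x_i^2 <= 2 (x_i - T_i)^2 + 2 T_i^2] and [(x_i - T_i)^2 <= C_ii D(x)]. *)
Lemma sq_norm_le_mahalanobis : exists2 K, 0 <= K &
  forall x, sq_norm x <= K * (1 + D x).
Proof.
pose C := trimmed_cov P phi.
have Cii i : 0 <= C i i by exact/ltW/posdef_diag_gt0/cov_phi_posdef.
exists (\sum_i (C i i *+ 2 + T i 0 ^+ 2 *+ 2)).
  by apply: sumr_ge0 => i _; rewrite addr_ge0 ?mulrn_wge0 ?sqr_ge0.
move=> x; rewrite mulr_suml; apply: ler_sum => i _.
have := coord_sqr_le_quad_form ((x : 'cV[R]_k) - T) i cov_phi_posdef.
rewrite -/C -[quad_form _ _]/(D x) [(_ - T) i 0]mxE [(- T) i 0]mxE.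
have := mahalanobis_ge0 x.
move: (D x) (C i i) (Cii i) (x i 0) (T i 0) => d c c0 a t d0 h.
have := sqr_ge0 (a - t - t); have := sqr_ge0 t.
have := mulr_ge0 c0 d0; have := mulr_ge0 (sqr_ge0 t) d0.
have -> : a ^+ 2 = (a - t) ^+ 2 *+ 2 + t ^+ 2 *+ 2 - (a - t - t) ^+ 2 by ring.
move: h; move: ((a - t) ^+ 2) ((a - t - t) ^+ 2) (t ^+ 2) => b e f h fd cd f0 e0.
have -> : (c *+ 2 + f *+ 2) * (1 + d) = c *+ 2 + f *+ 2 + c * d *+ 2 + f * d *+ 2.
  by ring.
rewrite !mulr2n; lra.
Qed.

(** The first order bound for the competitor [phi + g1 - g2], minus the equality attained by [phi].
    The masses of [g1] and [g2] may differ, so pure removal of mass is covered. *)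
Lemma perturbation g1 g2 : weight P g1 -> weight P g2 ->
  (forall x, g1 x <= 1 - phi x) -> (forall x, g2 x <= phi x) ->
  gamma <= mass phi + mass g1 - mass g2 ->
  wint P g2 D - k%:R * mass g2 <= wint P g1 D - k%:R * mass g1 /\
  (wint P g2 D - k%:R * mass g2 = wint P g1 D - k%:R * mass g1 ->
   forall i, wint P g1 (fun x => (x : 'cV[R]_k) i 0 - T i 0) =
             wint P g2 (fun x => (x : 'cV[R]_k) i 0 - T i 0)).
Proof.
move=> wg1 wg2 g1le g2le; pose psi x := phi x + g1 x - g2 x.
have wpsi : weight P psi by exact: weightDB wphi wg1 wg2 g1le g2le.
have psiE f : quad_growth f -> wint P psi f = wint P phi f + wint P g1 f - wint P g2 f.
  by move=> qf; rewrite /psi wintDB//; exact: wphi.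
have mpsi : mass psi = mass phi + mass g1 - mass g2.
  by rewrite psiE//; exact: quad_growth_cst.
rewrite -mpsi => gpsi.
have dets : \det (trimmed_cov P phi) <= \det (trimmed_cov P psi).
  have [_ ->//] := hphi; apply/trimming_classE; split => //.
  by rewrite massE ?lee_fin.
have [le0 eq0] : k%:R * mass psi <= wint P psi D /\
  (wint P psi D = k%:R * mass psi ->
   forall i, wint P psi (fun x => (x : 'cV[R]_k) i 0 - T i 0) = 0).
  exact: mcd_first_order k0 gamma0 hP wphi mass_phi_ge wpsi gpsi dets.
rewrite (psiE _ qD) mpsi wint_mahalanobis in le0 eq0.
split; first by move: le0; lra.
move=> e i; apply/eqP; rewrite -subr_eq0; apply/eqP.
rewrite -[RHS](eq0 _ i); last by lra.
rewrite psiE; last first.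
  by apply: quad_growthB; [exact: quad_growth_coord|exact: quad_growth_cst].
by rewrite wint_centred add0r.
Qed.

(** [perturbation] applied after scaling both parts to equal mass, where the terms in [k] and [T]
    cancel. The result compares the averages of [D] over [g2] and [g1], cross-multiplied so that
    zero masses are allowed. *)
Lemma exchange g1 g2 : weight P g1 -> weight P g2 ->
  (forall x, g1 x <= 1 - phi x) -> (forall x, g2 x <= phi x) ->
  mass g1 * wint P g2 D <= mass g2 * wint P g1 D /\
  (mass g1 * wint P g2 D = mass g2 * wint P g1 D ->
   forall i, mass g2 * wint P g1 (fun x => (x : 'cV[R]_k) i 0) =
             mass g1 * wint P g2 (fun x => (x : 'cV[R]_k) i 0)).
Proof.
move=> wg1 wg2 g1le g2le.
have m1 := mass_ge0 wg1; have m2 := mass_ge0 wg2.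
pose s := mass g1 + mass g2.
have := addr_ge0 m1 m2; rewrite -/s le_eqVlt => /predU1P[/esym s0|s0].
  have -> : mass g1 = 0 by rewrite /s in s0; lra.
  have -> : mass g2 = 0 by rewrite /s in s0; lra.
  by rewrite !mul0r; split => // _ i; rewrite !mul0r.
(* Each part is scaled by the mass of the other; division by the sum keeps both factors at most
   1. *)
pose c1 := mass g2 / s; pose c2 := mass g1 / s.
have c1P : 0 <= c1 <= 1.
  by rewrite divr_ge0 ?(ltW s0)//= ler_pdivrMr// mul1r lerDr.
have c2P : 0 <= c2 <= 1.
  by rewrite divr_ge0 ?(ltW s0)//= ler_pdivrMr// mul1r lerDl.
have wh1 := weightZ wg1 c1P; have wh2 := weightZ wg2 c2P.
have [|||le0 eq0] := perturbation wh1 wh2.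
- move=> x; apply: le_trans (g1le x); have /andP[_ ?] := c1P.
  by rewrite ler_piMl// (weight_ge0 _ wg1).
- move=> x; apply: le_trans (g2le x); have /andP[_ ?] := c2P.
  by rewrite ler_piMl// (weight_ge0 _ wg2).
- rewrite !wintZw//; try exact: quad_growth_cst.
  rewrite /c1 /c2 mulrAC (mulrAC (mass g1)) (mulrC (mass g1)) addrK.
  exact: mass_phi_ge.
have qc c : @quad_growth R k (fun=> c) by exact: quad_growth_cst.
have mm : c1 * mass g1 = c2 * mass g2.
  by rewrite /c1 /c2 mulrAC (mulrAC (mass g1)) (mulrC (mass g1)).
have cE a b : (c2 * a <= c1 * b) = (mass g1 * a <= mass g2 * b).
  by rewrite /c1 /c2 mulrAC (mulrAC (mass g2)) ler_pM2r ?invr_gt0.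
have cEe a b : (c2 * a = c1 * b) <-> (mass g1 * a = mass g2 * b).
  rewrite /c1 /c2 mulrAC (mulrAC (mass g2)); split => [|->//].
  by apply: mulIf; rewrite invr_neq0// gt_eqF.
move: le0 eq0; rewrite !wintZw//; try exact: qD.
rewrite mm lerD2r cE => le0 eq0; split => // /cEe e i.
have {eq0} := eq0 (congr1 (fun z => z - _) e) i.
have qi := @quad_growth_coord R k i.
rewrite !wintZw//; try exact: quad_growthB.
rewrite !wintB// !(wint_cst (T i 0))// !mulrBr.
rewrite (mulrCA c1) mm -(mulrCA c2) => /addIr /esym /cEe /esym.
by [].
Qed.

(** With mass to spare, a fixed fraction of [phi] could be removed on any measurable set. All these
    removals turn out to be equality cases, so every part of [phi] has barycentre [T] and [phi]
    lives on a hyperplane. *)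
Lemma mass_phi : mass phi = gamma.
Proof.
apply/eqP; rewrite eq_le mass_phi_ge andbT leNgt; apply/negP => mgt.
have m0 := mass_phi_gt0.
(* Removing [c * phi] everywhere would bring the mass down to exactly [gamma]; removing it on a
   subset therefore stays in the class. *)
pose c := (mass phi - gamma) / mass phi.
have c0 : 0 < c by rewrite divr_gt0// subr_gt0.
have cP : 0 <= c <= 1 by rewrite ltW//= ler_pdivrMr// mul1r gerBl ltW.
have qc a : @quad_growth R k (fun=> a) by exact: quad_growth_cst.
(* The zero weight, as nothing is added. *)
have w0 : weight P (fun x => 0 * phi x).
  by apply: weightZ; [exact: wphi|rewrite lexx ler01].
have key U : measurable U ->
    wint P (fun x => phi x * \1_U x) D - k%:R * mass (fun x => phi x * \1_U x) <= 0 /\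
    (wint P (fun x => phi x * \1_U x) D - k%:R * mass (fun x => phi x * \1_U x) = 0 ->
     forall i, wint P (fun x => phi x * \1_U x)
                 (fun x => (x : 'cV[R]_k) i 0 - T i 0) = 0).
  move=> mU; have wU := weight_indic wphi mU.
  have mUle : mass (fun x => phi x * \1_U x) <= mass phi.
    rewrite -(wint_setC wphi (qc 1) mU) lerDl; apply: mass_ge0.
    by apply: weight_indic; [exact: wphi|exact: measurableC].
  have [|||le0 eq0] := perturbation w0 (weightZ wU cP).
  - by move=> x; rewrite mul0r subr_ge0 (weight_le1 _ wphi).
  - move=> x; have phi0 := weight_ge0 x wphi.
    apply: (@le_trans _ _ (phi x * \1_U x)).
      by rewrite ler_piMl ?(weight_ge0 _ wU)//; case/andP: cP.
    by rewrite ler_piMr// indicE; case: (x \in U).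
  - rewrite !wintZw// ?mul0r ?addr0; [|exact: wphi].
    rewrite lerBrDr -lerBrDl; apply: (@le_trans _ _ (c * mass phi)).
      by rewrite ler_wpM2l// ltW.
    by rewrite /c mulfVK// gt_eqF.
  have qx i : quad_growth (fun x : Rk R k => (x : 'cV[R]_k) i 0 - T i 0).
    by apply: quad_growthB; [exact: quad_growth_coord|exact: qc].
  move: le0 eq0; rewrite !wintZw//; try exact: wphi; try exact: qD.
  rewrite !mul0r mulr0 subr0 (mulrCA k%:R) -mulrBr pmulr_rle0// => le0 eq0.
  split => // e i; have := eq0 _ i; rewrite e mulr0 => /(_ erefl).
  rewrite !wintZw//; try exact: wphi.
  by rewrite mul0r => /esym/eqP; rewrite mulf_eq0 gt_eqF//= => /eqP.
(* The contributions of [U] and of its complement are both at most 0 and add up to 0. *)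
have sum0 U : measurable U ->
    wint P (fun x => phi x * \1_U x) D - k%:R * mass (fun x => phi x * \1_U x) = 0.
  move=> mU; have [leU _] := key _ mU; have [leC _] := key _ (measurableC mU).
  have := wint_setC wphi qD mU; have := wint_setC wphi (qc 1) mU.
  rewrite wint_mahalanobis => <-; rewrite mulrDr => e.
  by apply/eqP; rewrite eq_le leU /=; move: e leC; lra.
pose i : 'I_k := Ordinal k0.
have ae0 : {ae P, forall x, ((x : 'cV[R]_k) i 0 - T i 0) * phi x = 0}.
  apply: wint_indic_eq0_ae; first exact: wphi.
    by apply: quad_growthB; [exact: quad_growth_coord|exact: qc].
  by move=> U mU; have [_ ->] := key _ mU => //; exact: sum0.
pose H : set (Rk R k) := [set x | ((delta_mx i 0 : 'cV[R]_k)^T *m x) 0 0 = T i 0].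
have HE (x : 'cV[R]_k) : ((delta_mx i 0 : 'cV[R]_k)^T *m x) 0 0 = x i 0.
  by rewrite trmx_delta -rowE mxE.
have /hP : affine_hyperplane H.
  exists (delta_mx i 0), (T i 0); split => //; apply/eqP.
  by move=> /matrixP/(_ i 0)/eqP; rewrite !mxE !eqxx oner_eq0.
apply/negP; rewrite -leNgt; apply: (@le_trans _ _ (mass phi)%:E).
  by rewrite lee_fin mass_phi_ge.
apply: mass_le_supp; [exact: wphi|exact: measurable_hyperplane|].
move: ae0; apply: ae_imp => x /eqP; rewrite mulf_eq0 subr_eq0 => /orP[/eqP xi|/eqP//].
by rewrite /H /= HE xi.
Qed.

(** * Cuts at a level of the distance *)

Lemma weight_below U s : measurable U -> (forall x, U x -> D x <= s) ->
  weight P (fun x => (1 - phi x) * \1_U x).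
Proof.
move=> mU Us; have [mphi phi01 _] := wphi; have [K K0 hK] := sq_norm_le_mahalanobis.
(* The absolute value keeps the bound nonnegative for negative [s]. *)
apply: (@weight_bounded _ _ _ _ (K * (1 + `|s|))).
- apply: measurable_funM; last exact: measurable_indic.
  exact: measurable_funB.
- move=> x; have /andP[? ?] := phi01 x; rewrite indicE.
  by case: (x \in U); rewrite ?mulr1 ?mulr0; apply/andP; split; lra.
- by rewrite mulr_ge0// addr_ge0.
- move=> x; rewrite indicE; have [xU _|_] := boolP (x \in U); last by rewrite mulr0 eqxx.
  apply: le_trans (hK x) _; rewrite ler_wpM2l// lerD2l.
  by rewrite (le_trans _ (ler_norm s))//; apply: Us; rewrite inE in xU.
Qed.

Lemma complement_indic_le U x : (1 - phi x) * \1_U x <= 1 - phi x.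
Proof. by rewrite ler_piMr ?subr_ge0 ?(weight_le1 _ wphi)// indicE; case: (x \in U). Qed.

Lemma phi_indic_le U x : phi x * \1_U x <= phi x.
Proof. by rewrite ler_piMr ?(weight_ge0 _ wphi)// indicE; case: (x \in U). Qed.

(** If both masses were positive, [exchange] would bound an average of values at least [s] by an
    average of values at most [s]; both would equal [s], against the strictness on one side. The two
    forms of strictness serve open and closed sublevel sets. *)
Lemma level_exchange U s : measurable U ->
  (forall x, U x -> D x <= s) -> (forall x, ~ U x -> s <= D x) ->
  (forall x, U x -> D x < s) \/ (forall x, ~ U x -> s < D x) ->
  mass (fun x => (1 - phi x) * \1_U x) = 0 \/
  mass (fun x => phi x * \1_(~` U) x) = 0.
Proof.
move=> mU Ule Uge Ustrict.
set g1 := fun x => _ * \1_U x; set g2 := fun x => _ * \1_(~` U) x.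
have w1 : weight P g1 by exact: weight_below mU Ule.
have w2 : weight P g2 by apply: weight_indic; [exact: wphi|exact: measurableC].
have qs : @quad_growth R k (fun=> s) by exact: quad_growth_cst.
have qD := quad_growth_mahalanobis.
have g1U x : g1 x != 0 -> U x.
  rewrite /g1 indicE; case: (boolP (x \in U)) => [|_]; first by rewrite inE.
  by rewrite mulr0 eqxx.
have g2U x : g2 x != 0 -> ~ U x.
  rewrite /g2 indicE in_setC; case: (boolP (x \in U)) => [_|/negP h _ /mem_set//].
  by rewrite mulr0 eqxx.
have p1 x : 0 <= (s - D x) * g1 x.
  have [->|/g1U/Ule h] := eqVneq (g1 x) 0; first by rewrite mulr0.
  by rewrite mulr_ge0 ?subr_ge0 ?(weight_ge0 _ w1).
have p2 x : 0 <= (D x - s) * g2 x.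
  have [->|/g2U/Uge h] := eqVneq (g2 x) 0; first by rewrite mulr0.
  by rewrite mulr_ge0 ?subr_ge0 ?(weight_ge0 _ w2).
have [le0 _] := exchange w1 w2 (complement_indic_le U) (phi_indic_le (~` U)).
have I1 := wint_ge0 P p1; have I2 := wint_ge0 P p2.
have m1 := mass_ge0 w1; have m2 := mass_ge0 w2.
have E1 : wint P g1 (fun x => s - D x) = s * mass g1 - wint P g1 D.
  by rewrite wintB// (wint_cst s).
have E2 : wint P g2 (fun x => D x - s) = wint P g2 D - s * mass g2.
  by rewrite wintB// (wint_cst s).
(* Both products are nonnegative, and [le0] says that their sum is at most 0. *)
have [Z1 Z2] : mass g2 * wint P g1 (fun x => s - D x) = 0 /\
               mass g1 * wint P g2 (fun x => D x - s) = 0.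
  have := mulr_ge0 m2 I1; have := mulr_ge0 m1 I2; rewrite E1 E2 !mulrBr.
  rewrite (mulrCA (mass g1) s) (mulrC (mass g1)) (mulrCA (mass g2) s) => ? ?.
  by split; lra.
case: Ustrict => [h|h].
  move/eqP: Z1; rewrite mulf_eq0 => /orP[/eqP->|/eqP Z1]; [by right|left].
  apply: wint_eq0_mass w1 (quad_growthB qs qD) p1 _ Z1 => x /eqP.
  rewrite mulf_eq0 => /orP[/eqP Dx|/eqP//]; apply/eqP/negPn/negP => /g1U/h.
  by move: Dx; lra.
move/eqP: Z2; rewrite mulf_eq0 => /orP[/eqP->|/eqP Z2]; [by left|right].
apply: wint_eq0_mass w2 (quad_growthB qD qs) p2 _ Z2 => x /eqP.
rewrite mulf_eq0 => /orP[/eqP Dx|/eqP//]; apply/eqP/negPn/negP => /g2U/h.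
by move: Dx; lra.
Qed.

Lemma measurable_mahalanobis : measurable_fun setT D.
Proof. by have [] := quad_growth_mahalanobis. Qed.

(** Splits [\1_U] into its parts under [phi] and [1 - phi], and [phi], of mass [gamma], into its
    parts on [U] and off it. A comparison of [P U] with [gamma] thus becomes one of the two
    exchangeable masses. *)
Lemma mass_balance U s : measurable U -> (forall x, U x -> D x <= s) ->
  fine (P U) + mass (fun x => phi x * \1_(~` U) x) =
  gamma + mass (fun x => (1 - phi x) * \1_U x).
Proof.
move=> mU Us; have w1 := weight_below mU Us.
have wU := weight_indic wphi mU.
have qc c : @quad_growth R k (fun=> c) by exact: quad_growth_cst.
have PU : fine (P U) =
    mass (fun x => phi x * \1_U x) + mass (fun x => (1 - phi x) * \1_U x).
  rewrite -[P U](_ : (\int[P]_x (\1_U x)%:E = _)%E); last first.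
    by rewrite integral_indic// setIT.
  rewrite -[LHS]/(\int[P]_x \1_U x) /wint -RintegralD//; first last.
  - exact: integrable_wint w1 (qc 1).
  - exact: integrable_wint wU (qc 1).
  by apply: eq_Rintegral => x _; ring.
by rewrite PU addrAC (wint_setC wphi (qc 1) mU) mass_phi.
Qed.

(** One of the two masses in [level_exchange] vanishes; if it is that of [1 - phi] below the level,
    the balance and the bound on [P U] make the other vanish as well. *)
Lemma phi_eq0_above s : (gamma%:E <= P [set x | (D x <= s)%R])%E ->
  {ae P, forall x, s < D x -> phi x = 0}.
Proof.
pose U : set (Rk R k) := [set x | D x <= s]; move=> PU.
change (is_true (gamma%:E <= P U)%E) in PU.
have mU : measurable U by apply: measurable_le_cst; exact: measurable_mahalanobis.
have nU x : ~ U x -> s < D x by move=> /negP; rewrite -ltNge.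
have wC : weight P (fun x => phi x * \1_(~` U) x).
  by apply: weight_indic; [exact: wphi|exact: measurableC].
have : mass (fun x => phi x * \1_(~` U) x) = 0.
  have [||||] // := @level_exchange U s mU; [by move=> x /nU/ltW|by right|].
  move=> m1; apply/eqP; rewrite eq_le mass_ge0// andbT.
  have := @mass_balance U s mU; rewrite m1 addr0 => /(_ (fun _ => id)).
  have : gamma <= fine (P U) by rewrite -lee_fin fineK// fin_num_measure.
  by lra.
move=> /(mass_eq0_ae wC); apply: ae_imp => x + sx.
rewrite indicE in_setC (_ : x \in U = false) ?mulr1//.
by apply/negP; rewrite inE /U /= leNgt sx.
Qed.

(** The mirror argument, with the open sublevel set and the reverse bound on its probability. *)
Lemma phi_eq1_below s : (P [set x | (D x < s)%R] <= gamma%:E)%E ->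
  {ae P, forall x, D x < s -> phi x = 1}.
Proof.
pose U : set (Rk R k) := [set x | D x < s]; move=> PU.
change (is_true (P U <= gamma%:E)%E) in PU.
have mU : measurable U by apply: measurable_lt_cst; exact: measurable_mahalanobis.
have Ule x : U x -> D x <= s by exact: ltW.
have w1 := weight_below mU Ule.
have : mass (fun x => (1 - phi x) * \1_U x) = 0.
  have [||||] // := @level_exchange U s mU; [by move=> x /negP; rewrite -leNgt|by left|].
  move=> m2; apply/eqP; rewrite eq_le mass_ge0// andbT.
  have := @mass_balance U s mU Ule; rewrite m2 addr0.
  have : fine (P U) <= gamma by rewrite -lee_fin fineK// fin_num_measure.
  by lra.
move=> /(mass_eq0_ae w1); apply: ae_imp => x + sx.
have xU : x \in U by exact: mem_set.
by rewrite indicE xU mulr1; lra.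
Qed.

(** * The minimizer on a single level set of the distance *)

Lemma measurable_set1_vector (x0 : Rk R k) : measurable [set x0].
Proof.
have -> : [set x0] = [set x : Rk R k | sq_norm ((x : 'cV[R]_k) - x0) = 0].
  apply/seteqP; split => x /= => [->|x0E].
    rewrite subrr /sq_norm big1// => i _.
    by rewrite [(0 : 'cV[R]_k) i 0]mxE expr0n.
  apply/matrixP => i j; rewrite ord1; apply/eqP; rewrite -subr_eq0.
  rewrite -sqrf_eq0 eq_le sqr_ge0.
  have := coord_sqr_le ((x : 'cV[R]_k) - x0) i; rewrite x0E.
  by rewrite [((x : 'cV[R]_k) - x0) i 0]mxE [(- (x0 : 'cV[R]_k)) i 0]mxE => ->.
apply: (@measurable_eq_cst _ _ R (fun x : Rk R k => sq_norm ((x : 'cV[R]_k) - x0))).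
apply: measurable_sum => i.
rewrite (_ : (fun x => _) = fun x : Rk R k => ((x : 'cV[R]_k) i 0 - (x0 : 'cV[R]_k) i 0) *
    ((x : 'cV[R]_k) i 0 - (x0 : 'cV[R]_k) i 0)); last first.
  by apply/funext => x; rewrite expr2 mxE [(- _ : 'cV[R]_k) i 0]mxE.
by have [] := quad_growth_affM i i ((x0 : 'cV[R]_k) i 0) ((x0 : 'cV[R]_k) i 0).
Qed.

(* Moving mass inside a level set of [D] does not change the average of [D], so
   every part of [phi] and of [1 - phi] there has the same barycentre [x0]. *)
Lemma level_set_trichotomy s :
  [\/ {ae P, forall x, D x = s -> phi x = 0},
      {ae P, forall x, D x = s -> phi x = 1}
    | exists2 x0, D x0 = s & P [set x | D x = s] = P [set x0]].
Proof.
pose B : set (Rk R k) := [set x | D x = s].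
have mB : measurable B by apply: measurable_eq_cst; exact: measurable_mahalanobis.
have BD x : x \in B -> D x = s by rewrite inE.
pose h1 x := (1 - phi x) * \1_B x; pose h2 x := phi x * \1_B x.
have w1 : weight P h1 by apply: (@weight_below _ s) => // x ->.
have w2 : weight P h2 by apply: weight_indic; [exact: wphi|].
have [m20|m20] := eqVneq (mass h2) 0.
  apply: Or31; have := mass_eq0_ae w2 m20; apply: ae_imp => x + xB.
  have {}xB : x \in B by exact: mem_set.
  by rewrite /h2 indicE xB mulr1.
have [m10|m10] := eqVneq (mass h1) 0.
  apply: Or32; have := mass_eq0_ae w1 m10; apply: ae_imp => x + xB.
  have {}xB : x \in B by exact: mem_set.
  by rewrite /h1 indicE xB mulr1; lra.
apply: Or33.
have qc c : @quad_growth R k (fun=> c) by exact: quad_growth_cst.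
have qi := @quad_growth_coord R k.
have levelE h : weight P h -> (forall x, x \notin B -> h x = 0) ->
    wint P h D = s * mass h.
  move=> wh hB; rewrite -wintZ// /wint; apply: eq_Rintegral => x _.
  have [/BD->|/hB->] := boolP (x \in B); first by rewrite mulr1.
  by rewrite !mulr0.
have h10 x : x \notin B -> h1 x = 0 by rewrite /h1 indicE => /negbTE ->; rewrite mulr0.
have h20 x : x \notin B -> h2 x = 0 by rewrite /h2 indicE => /negbTE ->; rewrite mulr0.
have bary U V i : measurable U -> measurable V ->
    mass (fun x => h2 x * \1_V x) *
      wint P (fun x => h1 x * \1_U x) (fun x => (x : 'cV[R]_k) i 0) =
    mass (fun x => h1 x * \1_U x) *
      wint P (fun x => h2 x * \1_V x) (fun x => (x : 'cV[R]_k) i 0).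
  move=> mU mV; have wU := weight_indic w1 mU; have wV := weight_indic w2 mV.
  have indic_le h (W : set (Rk R k)) : weight P h -> forall x, h x * \1_W x <= h x.
    by move=> wh x; rewrite ler_piMr ?(weight_ge0 _ wh)// indicE.
  have [||_] := exchange wU wV.
  - by move=> x; apply: le_trans (complement_indic_le B x); exact: (indic_le _ U w1 x).
  - by move=> x; apply: le_trans (phi_indic_le B x); exact: (indic_le _ V w2 x).
  apply; rewrite !levelE//; first by ring.
  - by move=> x /h10 ->; rewrite mul0r.
  - by move=> x /h20 ->; rewrite mul0r.
have indicT h : (fun x => h x * \1_setT x) = h.
  by apply/funext => x; rewrite indicT mulr1.
(* The barycentre of [h2]. Taking [V = setT] in [bary] gives it to every part of [h1], and then
   [U = setT] gives it to every part of [h2]. *)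
pose x0 : 'cV[R]_k := \col_i (wint P h2 (fun x => (x : 'cV[R]_k) i 0) / mass h2).
have x0i i : wint P h2 (fun x => (x : 'cV[R]_k) i 0) = x0 i 0 * mass h2.
  by rewrite mxE divfK.
have h1x0 U i : measurable U ->
    wint P (fun x => h1 x * \1_U x) (fun x => (x : 'cV[R]_k) i 0) =
    x0 i 0 * mass (fun x => h1 x * \1_U x).
  move=> mU; have := bary U setT i mU measurableT; rewrite !indicT x0i.
  by move=> e; apply: (mulfI m20); rewrite e; ring.
have h2x0 V i : measurable V ->
    wint P (fun x => h2 x * \1_V x) (fun x => (x : 'cV[R]_k) i 0) =
    x0 i 0 * mass (fun x => h2 x * \1_V x).
  move=> mV; have := bary setT V i measurableT mV.
  have := h1x0 setT i measurableT; rewrite !indicT => -> e.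
  by apply: (mulfI m10); rewrite -e; ring.
have conc h i : weight P h -> (forall U, measurable U ->
      wint P (fun x => h x * \1_U x) (fun x => (x : 'cV[R]_k) i 0) =
      x0 i 0 * mass (fun x => h x * \1_U x)) ->
    {ae P, forall x, ((x : 'cV[R]_k) i 0 - x0 i 0) * h x = 0}.
  move=> wh hx0; apply: wint_indic_eq0_ae => //; first exact: quad_growthB.
  move=> U mU; have wU := weight_indic wh mU.
  by rewrite wintB// (wint_cst (x0 i 0))// hx0// subrr.
have : {ae P, forall x, forall i, D x = s -> (x : 'cV[R]_k) i 0 = x0 i 0}.
  have FF := @ae_filter_ringOfSetsType _ _ _ P.
  apply: filter_forall => i.
  have c1 := conc h1 i w1 (fun U => @h1x0 U i).
  have c2 := conc h2 i w2 (fun U => @h2x0 U i).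
  near=> x => xB; have {}xB : x \in B by exact: mem_set.
  have : ((x : 'cV[R]_k) i 0 - x0 i 0) * h1 x = 0 by near: x.
  have : ((x : 'cV[R]_k) i 0 - x0 i 0) * h2 x = 0 by near: x.
  (* On [B] the weights [h1] and [h2] add up to 1, so the sum of the two vanishing products is
     [x i 0 - x0 i 0]. *)
  by rewrite /h1 /h2 indicE xB !mulr1; lra.
move=> [N [mN PN0 BN]].
have BN' : B `\` [set x0] `<=` N.
  move=> x [xB xx0]; apply: BN => /= h; apply: xx0.
  by apply/matrixP => i j; rewrite ord1; exact: h.
have mx0 := measurable_set1_vector x0.
have PB0 : P (B `\` [set x0]) = 0%E.
  by apply: subset_measure0 PN0 => //; exact: measurableD.
have PB : P B = P (B `&` [set x0]).
  by rewrite -[RHS]add0e -PB0; exact: measureDI.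
have PBpos : (0 < P B)%E.
  apply: (@lt_le_trans _ _ (mass h2)%:E).
    by rewrite lte_fin lt_neqAle eq_sym m20 mass_ge0.
  apply: mass_le_supp => //; apply: aeW => x xB; apply: h20.
  by apply/negP; rewrite inE.
(* All of [P] on [B] sits at [x0], so [B] would be null if it missed [x0], yet it carries the
   positive mass of [h2]. *)
have x0B : D x0 = s.
  apply: contrapT => nB; move: PBpos; rewrite PB.
  have -> : B `&` [set x0] = set0.
    by apply/seteqP; split => x // -[xB xE]; apply: nB; rewrite -xE.
  by rewrite measure0 ltxx.
exists x0 => //; rewrite -[LHS]/(P B) PB; congr (P _).
by apply/seteqP; split => x [] // ->.
Unshelve. all: by end_near. Qed.

(** * Ellipsoids as sublevel sets: interior and boundary *)

Lemma ellipsoidE s : ellipsoid T (trimmed_cov P phi) s%:E = [set x | D x <= s ^+ 2].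
Proof.
have sE : (s%:E ^+ 2 = (s ^+ 2)%:E)%E by rewrite EFin_expe.
by rewrite /ellipsoid sE; apply/seteqP; split => x /=; rewrite lee_fin.
Qed.

Lemma ellipsoid_pinfty : ellipsoid T (trimmed_cov P phi) +oo%E = setT.
Proof.
have yE : (+oo ^+ 2 = +oo :> \bar R)%E by rewrite expe2 mulyy.
by rewrite /ellipsoid yE; apply/seteqP; split => x //= _; rewrite leey.
Qed.

Lemma continuous_mahalanobis : continuous (D : 'cV[R]_k -> R).
Proof.
have -> : (D : 'cV[R]_k -> R) = fun y => \sum_i \sum_j
    invmx (trimmed_cov P phi) i j * ((y - T) i 0 * (y - T) j 0).
  by apply/funext => y; rewrite /mahalanobis quad_formE.
apply: continuous_sum => i; apply: continuous_sum => j x.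
have cB l : (fun y : 'cV[R]_k => (y - T) l 0) @ x --> (x - T) l 0.
  have -> : (fun y : 'cV[R]_k => (y - T) l 0) = fun y => y l 0 - T l 0.
    by apply/funext => y; rewrite mxE [(- T) l 0]mxE.
  rewrite [(x - T) l 0]mxE [(- T) l 0]mxE.
  have := @coord_continuous R k 1 l 0 x; set f := (fun y : 'cV[R]_k => y l 0) => cf.
  exact: (cvgB cf (cvg_cst (T l 0))).
exact: (cvgM (cvg_cst _) (cvgM (cB i) (cB j))).
Qed.

Lemma closed_sublevel c : closed ([set x | D x <= c] : set 'cV[R]_k).
Proof.
apply: (@closed_comp _ _ (D : 'cV[R]_k -> R) [set y | y <= c]); last exact: closed_le.
by move=> x _; exact: continuous_mahalanobis.
Qed.

Lemma mahalanobis_dilation (x : 'cV[R]_k) d :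
  D (x + d *: (x - T)) = (1 + d) ^+ 2 * D x.
Proof.
rewrite /mahalanobis; have -> : x + d *: (x - T) - T = (1 + d) *: (x - T).
  by rewrite scalerDl scale1r addrAC.
rewrite !quad_formE big_distrr/=; apply: eq_bigr => i _.
rewrite big_distrr/=; apply: eq_bigr => j _.
have e l : ((1 + d) *: (x - T)) l 0 = (1 + d) * (x - T) l 0 by rewrite mxE.
by rewrite !e; ring.
Qed.

(** A point at level [c] leaves the sublevel set under any slight dilation away from [T], because
    [c > 0] makes the growth of [D] strict; hence no ball around it stays inside. *)
Lemma interior_sublevel c : 0 < c ->
  ([set x | D x <= c] : set 'cV[R]_k)° = [set x | D x < c].
Proof.
move=> c0; apply/seteqP; split => x; last first.
  have oD : open ([set x | D x < c] : set 'cV[R]_k).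
    apply: (@open_comp _ _ (D : 'cV[R]_k -> R) [set y | y < c]); last exact: open_lt.
    by move=> y _; exact: continuous_mahalanobis.
  move=> xc; have := open_nbhs_nbhs (conj oD xc).
  by apply: filterS => y /ltW.
move=> /nbhs_ballP[e /= e0 xeE]; rewrite /= ltNge; apply/negP => cD.
have xc : D x = c.
  by apply/eqP; rewrite eq_le cD andbT; apply: xeE; exact: ballxx.
(* [M] exceeds every coordinate of [x - T] in absolute value, so the shift by [d *: (x - T)] stays
   within the sup norm ball of radius [e]. *)
pose M := 1 + \sum_i `|(x - T) i 0|; pose d := e / M.
have M0 : 0 < M by rewrite ltr_pwDl// sumr_ge0.
have d0 : 0 < d by rewrite divr_gt0.
have : D (x + d *: (x - T)) <= c.
  apply: xeE; split => // i j; rewrite ord1 /ball /=.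
  have -> : (x + d *: (x - T)) i 0 = x i 0 + d * (x - T) i 0.
    by rewrite mxE; congr (_ + _); rewrite mxE.
  rewrite opprD addrA subrr sub0r normrN normrM gtr0_norm//.
  rewrite /d mulrAC ltr_pdivrMr// ltr_pM2l// /M (bigD1 i)//=.
  rewrite addrCA ltrDl ltr_pwDl// sumr_ge0//.
rewrite mahalanobis_dilation xc ger_pMl// leNgt => /negP; apply.
by rewrite exprn_egt1// ltrDl.
Qed.

Lemma boundary_sublevel c : 0 < c ->
  boundary ([set x | D x <= c] : set 'cV[R]_k) = [set x | D x = c].
Proof.
move=> c0; rewrite /boundary interior_sublevel// -(closure_id _).1; last first.
  exact: closed_sublevel.
apply/seteqP; split => x /= => [[xc /negP]|->].
  by rewrite -leNgt => cx; apply/eqP; rewrite eq_le xc.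
by rewrite lexx ltxx.
Qed.

(** * The squared radius as a quantile of [D] *)

Lemma radius_fin_sublevel s : 0 < s -> (mcd_radius P gamma phi < s%:E)%E ->
  (gamma%:E <= P [set x | (D x <= s ^+ 2)%R])%E.
Proof.
move=> s0 /ereal_inf_lt[_ [t [t0 gt] <-]]; rewrite lte_fin => ts.
rewrite ellipsoidE in gt; apply: le_trans gt _; apply: le_measure.
- by rewrite inE; apply: measurable_le_cst; exact: measurable_mahalanobis.
- by rewrite inE; apply: measurable_le_cst; exact: measurable_mahalanobis.
- by move=> x /= /le_trans; apply; rewrite ler_pXn2r ?nnegrE ?ltW.
Qed.

(** By contraposition: a probability above [gamma] would make [s] a candidate in the infimum. *)
Lemma radius_fin_suplevel s : 0 < s -> (s%:E < mcd_radius P gamma phi)%E ->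
  (P [set x | (D x < s ^+ 2)%R] <= gamma%:E)%E.
Proof.
move=> s0; apply: contraTT; rewrite -ltNge -leNgt => gs.
apply: ereal_inf_lbound; exists s => //; split => //.
rewrite ellipsoidE; apply: le_trans (ltW gs) _; apply: le_measure.
- by rewrite inE; apply: measurable_lt_cst; exact: measurable_mahalanobis.
- by rewrite inE; apply: measurable_le_cst; exact: measurable_mahalanobis.
- by move=> x /= /ltW.
Qed.

Lemma radius_ge0 : (0 <= mcd_radius P gamma phi)%E.
Proof. by apply: le_ereal_inf_tmp => _ [s [s0 _] <-]; rewrite lee_fin ltW. Qed.

(** The cut is known at every radius strictly above [r]; a sequence decreasing to [r] exhausts the
    outside up to a countable union of null sets. *)
Lemma phi_eq0_outside r : mcd_radius P gamma phi = r%:E ->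
  {ae P, forall x, r ^+ 2 < D x -> phi x = 0}.
Proof.
move=> rE; have r0 : 0 <= r by rewrite -lee_fin -rE radius_ge0.
pose s (n : nat) := r + n.+1%:R^-1.
have s0 n : 0 < s n by rewrite ltr_wpDl// invr_gt0.
have /ae_foralln : forall n, {ae P, forall x, s n ^+ 2 < D x -> phi x = 0}.
  move=> n; apply/phi_eq0_above/radius_fin_sublevel => //.
  by rewrite rE lte_fin ltrDl invr_gt0.
apply: ae_imp => x sx rD; have D0 := mahalanobis_ge0 x.
pose d := Num.sqrt (D x) - r.
have d0 : 0 < d.
  rewrite subr_gt0 -(@ltr_pXn2r _ 2)// ?nnegrE// ?sqrtr_ge0//.
  by rewrite sqr_sqrtr.
(* For this index, [n.+1] exceeds [d^-1], so [s n] is below the square root of [D x]. *)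
apply: (sx (Num.truncn d^-1)); rewrite -[ltRHS]sqr_sqrtr//.
rewrite ltr_pXn2r ?nnegrE ?sqrtr_ge0 ?(ltW (s0 _))//.
rewrite /s -ltrBrDl -/d -[ltRHS]invrK ltf_pV2 ?posrE ?invr_gt0//.
exact: truncnS_gt.
Qed.

Lemma phi_eq1_inside_seq (s : nat -> R) : (forall n, 0 < s n) ->
  (forall n, (s n)%:E < mcd_radius P gamma phi)%E ->
  {ae P, forall x, forall n, D x < s n ^+ 2 -> phi x = 1}.
Proof.
move=> s0 sr; apply: ae_foralln => n.
by apply/phi_eq1_below/radius_fin_suplevel.
Qed.

(** With radius 0, [phi] would vanish wherever [D] is positive, that is off the point [T], and so
    live on any hyperplane through [T]. *)
Lemma radius_gt0 : (0 < mcd_radius P gamma phi)%E.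
Proof.
rewrite lt_neqAle radius_ge0 andbT; apply/negP => /eqP/esym/phi_eq0_outside.
rewrite expr0n /= => ae0; pose i : 'I_k := Ordinal k0.
pose H : set (Rk R k) := [set x | ((delta_mx i 0 : 'cV[R]_k)^T *m x) 0 0 =
  ((delta_mx i 0 : 'cV[R]_k)^T *m T) 0 0].
have /hP : affine_hyperplane H.
  exists (delta_mx i 0), (((delta_mx i 0 : 'cV[R]_k)^T *m T) 0 0); split => //.
  by apply/eqP => /matrixP/(_ i 0)/eqP; rewrite !mxE !eqxx oner_eq0.
apply/negP; rewrite -leNgt -mass_phi.
apply: mass_le_supp; [exact: wphi|exact: measurable_hyperplane|].
move: ae0; apply: ae_imp => x + xH; apply.
have [_ Qpos] := posdef_invmx cov_phi_posdef; apply: Qpos; rewrite subr_eq0.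
by apply/eqP => xT; apply: xH; rewrite /H /= xT.
Qed.

Lemma phi_eq1_inside r : mcd_radius P gamma phi = r%:E ->
  {ae P, forall x, D x < r ^+ 2 -> phi x = 1}.
Proof.
move=> rE; have r0 : 0 < r by rewrite -lte_fin -rE radius_gt0.
(* The offset 2 keeps [s 0] positive. *)
pose s (n : nat) := r - r / n.+2%:R.
have s0 n : 0 < s n.
  by rewrite subr_gt0 ltr_pdivrMr// ltr_pMr// ltr1n.
have sr n : ((s n)%:E < mcd_radius P gamma phi)%E.
  by rewrite rE lte_fin gtrBl divr_gt0.
have := phi_eq1_inside_seq s0 sr; apply: ae_imp => x sx rD.
have D0 := mahalanobis_ge0 x; pose d := r - Num.sqrt (D x).
have d0 : 0 < d.
  rewrite subr_gt0 -(@ltr_pXn2r _ 2)// ?nnegrE ?sqrtr_ge0 ?(ltW r0)//.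
  by rewrite sqr_sqrtr.
apply: (sx (Num.truncn (r / d))).
rewrite -[ltLHS]sqr_sqrtr// ltr_pXn2r ?nnegrE ?sqrtr_ge0 ?(ltW (s0 _))//.
rewrite /s ltrBrDr addrC -ltrBrDr -/d ltr_pdivrMr// mulrC -ltr_pdivrMr//.
by apply: lt_trans (truncnS_gt _) _; rewrite ltr_nat.
Qed.

(** Every positive integer lies below the radius, and the sublevel sets at their squares exhaust the
    space. *)
Lemma phi_eq1_pinfty : mcd_radius P gamma phi = +oo%E ->
  {ae P, forall x, phi x = 1}.
Proof.
move=> rE; have sr n : (n.+1%:R%:E < mcd_radius P gamma phi)%E by rewrite rE ltry.
have s0 n : 0 < n.+1%:R :> R by [].
have := phi_eq1_inside_seq s0 sr; apply: ae_imp => x sx.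
apply: (sx (Num.truncn (Num.sqrt (D x)))); have D0 := mahalanobis_ge0 x.
rewrite -[ltLHS]sqr_sqrtr// ltr_pXn2r ?nnegrE ?sqrtr_ge0//.
exact: truncnS_gt.
Qed.

Lemma mcd_ellipsoidE r : mcd_radius P gamma phi = r%:E ->
  mcd_ellipsoid P gamma phi = [set x | D x <= r ^+ 2].
Proof. by rewrite /mcd_ellipsoid => ->; exact: ellipsoidE. Qed.

Lemma mcd_ellipsoid_pinfty : mcd_radius P gamma phi = +oo%E ->
  mcd_ellipsoid P gamma phi = setT.
Proof. by rewrite /mcd_ellipsoid => ->; exact: ellipsoid_pinfty. Qed.

Lemma radiusP : mcd_radius P gamma phi = +oo%E \/
  exists2 r, 0 < r & mcd_radius P gamma phi = r%:E.
Proof.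
have := radius_gt0; case: (mcd_radius P gamma phi) => [r r0||//]; last by left.
by right; exists r => //; rewrite -lte_fin.
Qed.

End minimizer.

Theorem theorem3p2 (R : realType) (k : nat) (hk : (1 <= k)%N)
    (gamma : R) (hgamma0 : 0 < gamma) (hgamma1 : gamma <= 1)
    (P : probability (Rk R k) R)
    (hP : forall H : set 'cV[R]_k, affine_hyperplane H -> (P H < gamma%:E)%E)
    (phi : Rk R k -> R) (hphi : mcd_minimizer P gamma phi) :
  let E := mcd_ellipsoid P gamma phi in
  [/\ (\int[P]_x (phi x)%:E = gamma%:E)%E,
      {ae P, forall x, \1_(E°) x <= phi x <= \1_E x}
    & [\/ {ae P, forall x, boundary E x -> phi x = 0},
          {ae P, forall x, boundary E x -> phi x = 1}
        | exists2 x : 'cV[R]_k, boundary E x & P (boundary E) = P [set x]]].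
Proof.
move=> E; have wphi := weight_phi hphi.
have mphi : (\int[P]_x (phi x)%:E = gamma%:E)%E.
  by rewrite massE// (mass_phi hk hgamma0 hP hphi).
have [rE|[r r0 rE]] := radiusP hk hgamma0 hP hphi.
  (* For an infinite radius the boundary is empty, and the first alternative holds vacuously. *)
  have ET : E = setT by exact: mcd_ellipsoid_pinfty rE.
  rewrite ET /boundary interiorT closureT setDv; split=> //; last first.
    by apply: Or31; exact: aeW.
  have := phi_eq1_pinfty hk hgamma0 hP hphi rE; apply: ae_imp => x ->.
  by rewrite indicT lexx.
have EE : E = [set x | mahalanobis P phi x <= r ^+ 2] by exact: mcd_ellipsoidE rE.
have c0 : 0 < r ^+ 2 by rewrite exprn_gt0.
rewrite EE interior_sublevel// boundary_sublevel//; split=> //; last first.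
  exact: (level_set_trichotomy hk hgamma0 hP hphi).
have FF := @ae_filter_ringOfSetsType _ _ _ P.
have out := phi_eq0_outside hk hgamma0 hP hphi rE.
have ins := phi_eq1_inside hk hgamma0 hP hphi rE.
near=> x; have phi0 : r ^+ 2 < mahalanobis P phi x -> phi x = 0 by near: x.
have phi1 : mahalanobis P phi x < r ^+ 2 -> phi x = 1 by near: x.
(* At the level [r ^+ 2] itself the two bounds reduce to [0 <= phi x <= 1]. *)
apply/andP; split.
  rewrite indicE; case: (boolP (x \in _)) => [|_]; last exact: weight_ge0 wphi.
  by rewrite inE => /phi1 ->.
rewrite indicE; case: (boolP (x \in _)) => [_|]; first exact: weight_le1 wphi.
move=> /negP h; rewrite phi0// ltNge; apply/negP => xr; apply: h.
by rewrite inE.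
Unshelve. all: by end_near. Qed.
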